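(* Let $\Psi\in\mathcal{H}(\mathbb{D})$ be any convex univalent function with $\Psi(0)=1$ and $\operatorname{Re}\Psi(z)>0$ for all $z\in\mathbb{D}$. Let $$\mathcal{F}=\left\{f\in\mathcal{H}_0(\mathbb{D}):\ \frac{zf'(z)}{f(z)}\prec\Psi(z)\right\}.$$ Then $\mathcal{B}_c(\mathcal{F})\subset\mathcal{F}$ for every $c=0,1,2,\dots$.
   Context: $\mathbb{D}$ is the open unit disk in $\mathbb{C}$, $\mathcal{H}(\mathbb{D})$ is the class of functions analytic in $\mathbb{D}$, and $\mathcal{H}_0(\mathbb{D})$ is the set of $f\in\mathcal{H}(\mathbb{D})$ with $f(0)=0$ and $f'(0)=1$. A convex univalent function is a univalent analytic function on $\mathbb{D}$ whose image is a convex set. For $f,g\in\mathcal{H}(\mathbb{D})$, $f$ is subordinate to $g$, written $f(z)\prec g(z)$, if there is $\omega\in\mathcal{H}(\mathbb{D})$ with $\omega(0)=0$ and $|\omega(z)|<1$ on $\mathbb{D}$ such that $f(z)=g(\omega(z))$. In the definition of $\mathcal{F}$, $zf'(z)/f(z)$ is understood to be analytic in $\mathbb{D}$ (with value $1$ at $z=0$; in particular $f\ne0$ on $\mathbb{D}\setminus\{0\}$). The Bernardi transform of $f\in\mathcal{H}_0(\mathbb{D})$ is $$\mathcal{B}_c(f)(z)=\frac{1+c}{z^c}\int_0^z \zeta^{c-1}f(\zeta)\,d\zeta,$$ extended analytically to $z=0$ with value $0$. *)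

(* Defs.v *)
From Stdlib Require Import Reals.
From Coquelicot Require Import Coquelicot.
Open Scope C_scope.

(* Functions on the disk are total functions [C -> C] of which only the
   restriction to the disk matters. *)

Definition disk (z : C) : Prop := (Cmod z < 1)%R.

Definition analytic (f : C -> C) : Prop :=
  forall z : C, disk z -> ex_derive f z.

Definition analytic0 (f : C -> C) : Prop :=
  analytic f /\ f 0 = 0 /\ C_derive f 0 = 1.

Definition univalent (f : C -> C) : Prop :=
  forall z w : C, disk z -> disk w -> f z = f w -> z = w.

Definition convex (A : C -> Prop) : Prop :=
  forall (u v : C) (t : R), A u -> A v -> (0 <= t <= 1)%R ->
    A (RtoC (1 - t) * u + RtoC t * v).

Definition image_disk (f : C -> C) (w : C) : Prop :=
  exists z : C, disk z /\ f z = w.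

Definition convex_univalent (f : C -> C) : Prop :=
  analytic f /\ univalent f /\ convex (image_disk f).

Definition subordinate (f g : C -> C) : Prop :=
  analytic f /\ analytic g /\
  exists omega : C -> C,
    analytic omega /\ omega 0 = 0 /\
    (forall z : C, disk z -> (Cmod (omega z) < 1)%R) /\
    (forall z : C, disk z -> f z = g (omega z)).

(* z f'(z) / f(z), with its value 1 at the origin. *)
Definition log_quotient (f : C -> C) (z : C) : C :=
  if Ceq_dec z 0 then 1 else z * C_derive f z / f z.

(* The non-vanishing of [f] is stated separately because division by zero is
   total here; the analyticity of [log_quotient f] is part of [subordinate]. *)
Definition class_F (Psi f : C -> C) : Prop :=
  analytic0 f /\
  (forall z : C, disk z -> z <> 0 -> f z <> 0) /\
  subordinate (log_quotient f) Psi.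

(* Integral over the segment [0, z], parametrized by t |-> t z, 0 <= t <= 1. *)
Definition integral_0 (g : C -> C) (z : C) : C :=
  RInt (V := C_R_CompleteNormedModule) (fun t : R => z * g (RtoC t * z)) 0 1.

(* zeta ^ (c - 1) is written zeta ^ c / zeta so as to cover c = 0. For f
   analytic with f 0 = 0, the integrand has at most a removable singularity at
   zeta = 0; its value there does not affect the integral, and the integral
   over any path in the disk is the one over the segment. *)
Definition Bernardi (c : nat) (f : C -> C) (z : C) : C :=
  if Ceq_dec z 0 then 0
  else (1 + RtoC (INR c)) / z ^ c *
       integral_0 (fun zeta => zeta ^ c / zeta * f zeta) z.

(* Main.v *)
(* With h = f / z, the transform is F = z G for G z = (1 + c) \int_0^1 t^c h (t z) dt. Put
   q = z f' / f, p = z F' / F and s = G / ((1 + c) h), so that s = 1 / (p + c), and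
   z s' + (q + c) s = 1,  q = p + z p' s.
   Where the real part of a function u is maximal on a closed disk, z u' is real and nonnegative.
   Applied to u = - s this gives Re s > 0; applied to u = - k p it shows that a half-plane
   containing the range of q contains the range of p. The image of Psi is convex and open, hence an
   intersection of half-planes, so p takes its values in it and p = Psi (omega) with
   omega = Psi^-1 (p). Openness of the image and analyticity of Psi^-1 rest on the maximum
   modulus principle for pointwise complex differentiable functions, obtained from Goursat's
   bisection argument. *)

Require Import Defs.
From Stdlib Require Import Reals Lra Classical ClassicalEpsilon.
From Coquelicot Require Import Coquelicot.
Open Scope C_scope.

(** * Complex differentiability *)

(** [analytic] only provides a derivative at each point, and continuity of derivatives is not
    established in general. It is needed for h', which gets integrated, and there it comes from the
    class itself: z h' = h (q - 1), so h' is h times the difference quotient of q at 0, a continuous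
    function because q is analytic. The order s, then p, is dictated by the denominators. Since f
    has no zero off the origin, h has none in the disk and s can be formed at once; p has G in its
    denominator, and it is Re s > 0 that excludes zeros of G. Extrema are taken over the closed disk
    through an arbitrary point of the open one. They may fall inside it, even at the centre, and the
    sign of z u' still holds there, so boundary behaviour never enters. *)

Definition Cdiff (f : C -> C) (z l : C) : Prop :=
  is_derive (K := C_AbsRing) (V := C_NormedModule) f z l.

Lemma scal_C_linear (V : NormedModule C_AbsRing) (l : V) :
  is_linear (K := C_AbsRing) (U := AbsRing_NormedModule C_AbsRing) (fun y : C => scal y l).
Proof. exact (is_linear_scal_l (K := C_AbsRing) l). Qed.

Lemma Cdiff_iff (f : C -> C) (z l : C) :
  Cdiff f z l <->
  (forall eps : R, (0 < eps)%R -> exists d : R, (0 < d)%R /\ forall w : C,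
    (Cmod (w - z) < d)%R -> (Cmod (f w - f z - (w - z) * l) <= eps * Cmod (w - z))%R).
Proof.
split.
- intros [_ H] eps Heps.
  destruct (H z (fun P HP => HP) (mkposreal eps Heps)) as [d Hd].
  exists d; split; [apply cond_pos|].
  intros w Hw. exact (Hd w Hw).
- intros H; split; [apply scal_C_linear|].
  intros x Hx [eps Heps].
  rewrite <- (@is_filter_lim_locally_unique C_AbsRing (AbsRing_NormedModule C_AbsRing) z x Hx).
  destruct (H eps Heps) as [d [Hd0 Hd]].
  exists (mkposreal d Hd0). intros w Hw. exact (Hd w Hw).
Qed.

(** The product and chain rules speak of C as a module over its own absolute ring, [C_derive] of
    [C_NormedModule]. Both notions unfold to the same estimate in [Cmod]. *)
Lemma Cdiff_AbsRing (f : C -> C) (z l : C) :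
  Cdiff f z l <-> is_derive (K := C_AbsRing) (V := AbsRing_NormedModule C_AbsRing) f z l.
Proof.
rewrite Cdiff_iff; split.
- intros H; split; [apply scal_C_linear|].
  intros x Hx [eps Heps].
  rewrite <- (@is_filter_lim_locally_unique C_AbsRing (AbsRing_NormedModule C_AbsRing) z x Hx).
  destruct (H eps Heps) as [d [Hd0 Hd]].
  exists (mkposreal d Hd0). intros w Hw. exact (Hd w Hw).
- intros [_ H] eps Heps.
  destruct (H z (fun P HP => HP) (mkposreal eps Heps)) as [d Hd].
  exists d; split; [apply cond_pos|].
  intros w Hw. exact (Hd w Hw).
Qed.

Lemma Cdiff_mult (f g : C -> C) (z a b : C) :
  Cdiff f z a -> Cdiff g z b -> Cdiff (fun w => f w * g w) z (a * g z + f z * b).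
Proof.
rewrite !Cdiff_AbsRing; intros Hf Hg.
apply (is_derive_mult f g z a b Hf Hg). exact Cmult_comm.
Qed.

Lemma Cdiff_comp (f g : C -> C) (z a b : C) :
  Cdiff f (g z) a -> Cdiff g z b -> Cdiff (fun w => f (g w)) z (b * a).
Proof.
rewrite (Cdiff_AbsRing g); intros Hf Hg.
exact (is_derive_comp (K := C_AbsRing) (V := C_NormedModule) f g z a b Hf Hg).
Qed.

Lemma Cdiff_plus (f g : C -> C) (z a b : C) :
  Cdiff f z a -> Cdiff g z b -> Cdiff (fun w => f w + g w) z (a + b).
Proof. intros Hf Hg; exact (is_derive_plus f g z a b Hf Hg). Qed.

Lemma Cdiff_const (a z : C) : Cdiff (fun _ => a) z 0.
Proof. exact (is_derive_const a z). Qed.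

Lemma Cdiff_id (z : C) : Cdiff (fun w => w) z 1.
Proof. rewrite Cdiff_AbsRing. exact (is_derive_id z). Qed.

Lemma Cdiff_ext_loc (f g : C -> C) (z l : C) (d : R) :
  (0 < d)%R -> (forall w, (Cmod (w - z) < d)%R -> f w = g w) -> Cdiff f z l -> Cdiff g z l.
Proof.
intros Hd He. rewrite !Cdiff_iff; intros H eps Heps.
destruct (H eps Heps) as [d' [Hd' H']].
exists (Rmin d d'); split; [now apply Rmin_pos|].
intros w Hw. rewrite <- (He w), <- (He z).
- apply H'. apply Rlt_le_trans with (1 := Hw), Rmin_r.
- replace (z - z) with (RtoC 0) by ring. rewrite Cmod_0; exact Hd.
- apply Rlt_le_trans with (1 := Hw), Rmin_l.
Qed.

Definition Ccont (f : C -> C) (z : C) : Prop :=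
  forall eps : R, (0 < eps)%R -> exists d : R, (0 < d)%R /\ forall w : C,
    (Cmod (w - z) < d)%R -> (Cmod (f w - f z) < eps)%R.

Lemma Cdiff_cont (f : C -> C) (z l : C) : Cdiff f z l -> Ccont f z.
Proof.
rewrite Cdiff_iff; intros H eps Heps.
destruct (H 1%R Rlt_0_1) as [d [Hd H']].
assert (Hl := Cmod_ge_0 l).
assert (He : (0 < eps / (1 + Cmod l))%R) by (apply Rdiv_lt_0_compat; lra).
exists (Rmin d (eps / (1 + Cmod l))); split; [now apply Rmin_pos|].
intros w Hw.
assert (H1 := H' w (Rlt_le_trans _ _ _ Hw (Rmin_l _ _))).
assert (H2 : (Cmod (w - z) < eps / (1 + Cmod l))%R)
  by (apply Rlt_le_trans with (1 := Hw), Rmin_r).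
replace (f w - f z) with ((f w - f z - (w - z) * l) + (w - z) * l) by ring.
apply Rle_lt_trans with (1 := Cmod_triangle _ _).
rewrite Cmod_mult.
apply Rmult_lt_compat_r with (r := (1 + Cmod l)%R) in H2; [|lra].
replace (eps / (1 + Cmod l) * (1 + Cmod l))%R with eps in H2 by (field; lra).
nra.
Qed.

Lemma Cmod_tri_sub (a b : C) : (Cmod a - Cmod b <= Cmod (a - b))%R.
Proof.
assert (H := Cmod_triangle (a - b) b).
replace (a - b + b) with a in H by ring. lra.
Qed.

Lemma Cmod_sub_sym (a b : C) : Cmod (a - b) = Cmod (b - a).
Proof. rewrite <- Cmod_opp. f_equal; ring. Qed.

Lemma Cdiff_Cinv (a : C) : a <> 0 -> Cdiff Cinv a (- / (a * a)).
Proof.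
intros Ha. rewrite Cdiff_iff. intros eps Heps.
assert (Ha' := proj1 (Cmod_gt_0 a) Ha).
set (A := Cmod a) in *.
(* The remainder is (w - a)^2 / (w a^2), and the first radius ensures |w| > A / 2. *)
exists (Rmin (A / 2) (eps * (A * A * A) / 2)); split.
{ apply Rmin_pos; [lra|]. apply Rdiv_lt_0_compat; [|lra].
  apply Rmult_lt_0_compat; [lra|]. repeat apply Rmult_lt_0_compat; lra. }
intros w Hw.
assert (H1 : (Cmod (w - a) < A / 2)%R) by (apply Rlt_le_trans with (1 := Hw), Rmin_l).
assert (H2 : (Cmod (w - a) < eps * (A * A * A) / 2)%R) by (apply Rlt_le_trans with (1 := Hw), Rmin_r).
assert (H3 := Cmod_tri_sub a w). rewrite Cmod_sub_sym in H3. fold A in H3.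
assert (Hw0 : w <> 0). { apply Cmod_gt_0. lra. }
replace (/ w - / a - (w - a) * - / (a * a)) with ((w - a) * ((w - a) / (w * (a * a))))
  by (field; tauto).
rewrite Cmod_mult, Cmod_div by (repeat apply Cmult_neq_0; assumption).
rewrite !Cmod_mult. fold A.
assert (Hx := Cmod_ge_0 (w - a)).
rewrite Rmult_comm. apply Rmult_le_compat_r; [exact Hx|].
apply Rmult_le_reg_r with (Cmod w * (A * A))%R.
{ repeat apply Rmult_lt_0_compat; lra. }
unfold Rdiv at 1. rewrite Rmult_assoc, Rinv_l, Rmult_1_r.
2:{ apply Rgt_not_eq. repeat apply Rmult_lt_0_compat; lra. }
apply Rle_trans with (eps * (A * A * A) / 2)%R; [lra|].
replace (eps * (A * A * A) / 2)%R with (eps * (A * A) * (A / 2))%R by field.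
replace (eps * (Cmod w * (A * A)))%R with (eps * (A * A) * Cmod w)%R by ring.
apply Rmult_le_compat_l; [|lra].
repeat apply Rmult_le_pos; lra.
Qed.

Lemma Cdiff_inv (f : C -> C) (z l : C) :
  Cdiff f z l -> f z <> 0 -> Cdiff (fun w => / f w) z (- l / (f z * f z)).
Proof.
intros Hf Hz.
replace (- l / (f z * f z)) with (l * (- / (f z * f z))) by (field; exact Hz).
apply (Cdiff_comp Cinv f); [now apply Cdiff_Cinv | exact Hf].
Qed.

Lemma Cdiff_eq (f : C -> C) (z a b : C) : Cdiff f z a -> a = b -> Cdiff f z b.
Proof. now intros H <-. Qed.

Lemma Cdiff_opp (f : C -> C) (z a : C) : Cdiff f z a -> Cdiff (fun w => - f w) z (- a).
Proof. intros Hf; exact (is_derive_opp f z a Hf). Qed.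

Lemma Cdiff_minus (f g : C -> C) (z a b : C) :
  Cdiff f z a -> Cdiff g z b -> Cdiff (fun w => f w - g w) z (a - b).
Proof. intros Hf Hg. apply Cdiff_plus; [exact Hf | now apply Cdiff_opp]. Qed.

Lemma Cdiff_div (f g : C -> C) (z a b : C) :
  Cdiff f z a -> Cdiff g z b -> g z <> 0 ->
  Cdiff (fun w => f w / g w) z ((a * g z - f z * b) / (g z * g z)).
Proof.
intros Hf Hg Hz.
eapply Cdiff_eq; [apply (Cdiff_mult f (fun w => / g w)); [exact Hf | apply Cdiff_inv; eassumption] |].
cbv beta. field. exact Hz.
Qed.

Lemma Cdiff_pow (f : C -> C) (z l : C) (n : nat) :
  Cdiff f z l -> exists m, Cdiff (fun w => f w ^ n) z m.
Proof.
intros H. induction n as [|n [m IH]].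
- exists 0. exact (Cdiff_const 1 z).
- eexists. simpl. apply Cdiff_mult; eassumption.
Qed.

Lemma analytic_Cdiff (f : C -> C) (z : C) : analytic f -> disk z -> Cdiff f z (C_derive f z).
Proof. intros H Hz. apply C_derive_correct; [exact z | now apply H]. Qed.

(** * Restriction to segments and the mean value inequality *)

Lemma Re_le_Cmod (z : C) : (Re z <= Cmod z)%R.
Proof. apply Rle_trans with (1 := Rle_abs _), re_le_Cmod. Qed.

Lemma is_derive_Re_path (f : C -> C) (a b l : C) (t : R) :
  Cdiff f (a + t * b) l ->
  is_derive (fun t : R => Re (f (a + t * b))) t (Re (b * l)).
Proof.
rewrite Cdiff_iff; intros H.
apply is_derive_Reals. intros eps Heps.
(* The added 1 keeps [B] positive when b = 0. *)
set (B := (1 + Cmod b)%R). assert (HB0 := Cmod_ge_0 b).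
destruct (H (eps / (2 * B))%R) as [d [Hd H']].
{ apply Rdiv_lt_0_compat; unfold B; lra. }
assert (HdB : (0 < d / B)%R) by (apply Rdiv_lt_0_compat; unfold B; lra).
exists (mkposreal _ HdB). intros k Hk Hkd; simpl in Hkd.
assert (Hk0 := Rabs_pos_lt _ Hk).
assert (E : a + (t + k)%R * b - (a + t * b) = k * b) by (rewrite RtoC_plus; ring).
assert (Hb : (Cmod (k * b) <= Rabs k * B)%R).
{ rewrite Cmod_mult, Cmod_R. unfold B. apply Rmult_le_compat_l; lra. }
assert (Hlt : (Rabs k * B < d)%R).
{ apply Rmult_lt_compat_r with (r := B) in Hkd; [|unfold B; lra].
  replace (d / B * B)%R with d in Hkd by (field; unfold B; lra). exact Hkd. }
assert (H1 := H' (a + (t + k)%R * b)). rewrite E in H1.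
specialize (H1 (Rle_lt_trans _ _ _ Hb Hlt)).
replace ((Re (f (a + (t + k)%R * b)%C) - Re (f (a + t * b)%C)) / k - Re (b * l)%C)%R
  with (Re (f (a + (t + k)%R * b) - f (a + t * b) - k * b * l)%C / k)%R.
2:{ unfold Re; simpl. field. exact Hk. }
unfold Rdiv. rewrite Rabs_mult, Rabs_inv.
apply Rmult_lt_reg_r with (Rabs k); [exact Hk0|].
rewrite Rmult_assoc, Rinv_l, Rmult_1_r by lra.
apply Rle_lt_trans with (1 := re_le_Cmod _), Rle_lt_trans with (1 := H1).
apply Rle_lt_trans with (eps / (2 * B) * (Rabs k * B))%R.
{ apply Rmult_le_compat_l; [|exact Hb]. apply Rlt_le, Rdiv_lt_0_compat; unfold B; lra. }
replace (eps / (2 * B) * (Rabs k * B))%R with (eps * Rabs k / 2)%R by (field; unfold B; lra).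
assert (0 < eps * Rabs k)%R by now apply Rmult_lt_0_compat. lra.
Qed.

Lemma Ccont_scal (f : C -> C) (z k : C) : Ccont f z -> Ccont (fun w => k * f w) z.
Proof.
intros Hf eps Heps. assert (Hk := Cmod_ge_0 k).
destruct (Hf (eps / (1 + Cmod k))%R) as [d [Hd0 H]]; [apply Rdiv_lt_0_compat; lra|].
exists d; split; [exact Hd0|]. intros w Hw. specialize (H w Hw).
replace (k * f w - k * f z) with (k * (f w - f z)) by ring. rewrite Cmod_mult.
apply Rmult_lt_compat_l with (r := (1 + Cmod k)%R) in H; [|lra].
replace ((1 + Cmod k) * (eps / (1 + Cmod k)))%R with eps in H by (field; lra).
assert (H0 := Cmod_ge_0 (f w - f z)). nra.
Qed.

Lemma Ccont_plus (f g : C -> C) (z : C) :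
  Ccont f z -> Ccont g z -> Ccont (fun w => f w + g w) z.
Proof.
intros Hf Hg eps Heps.
destruct (Hf (eps / 2)%R) as [d [Hd H]]; [lra|].
destruct (Hg (eps / 2)%R) as [d' [Hd' H']]; [lra|].
exists (Rmin d d'); split; [now apply Rmin_pos|]. intros w Hw.
specialize (H w (Rlt_le_trans _ _ _ Hw (Rmin_l _ _))).
specialize (H' w (Rlt_le_trans _ _ _ Hw (Rmin_r _ _))).
replace (f w + g w - (f z + g z)) with ((f w - f z) + (g w - g z)) by ring.
apply Rle_lt_trans with (1 := Cmod_triangle _ _). lra.
Qed.

Lemma Ccont_mult (f g : C -> C) (z : C) :
  Ccont f z -> Ccont g z -> Ccont (fun w => f w * g w) z.
Proof.
intros Hf Hg eps Heps.
assert (Hf0 := Cmod_ge_0 (f z)). assert (Hg0 := Cmod_ge_0 (g z)).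
set (m := (1 + Cmod (f z) + Cmod (g z))%R).
set (eta := Rmin 1 (eps / m)).
assert (Heta : (0 < eta)%R).
{ apply Rmin_pos; [lra|]. apply Rdiv_lt_0_compat; unfold m; lra. }
assert (He1 : (eta <= 1)%R) by apply Rmin_l.
assert (He2 : (eta * m <= eps)%R).
{ assert (H : (eta <= eps / m)%R) by apply Rmin_r.
  apply Rmult_le_compat_r with (r := m) in H; [|unfold m; lra].
  replace (eps / m * m)%R with eps in H by (field; unfold m; lra). exact H. }
destruct (Hf eta Heta) as [d [Hd H]]. destruct (Hg eta Heta) as [d' [Hd' H']].
exists (Rmin d d'); split; [now apply Rmin_pos|]. intros w Hw.
specialize (H w (Rlt_le_trans _ _ _ Hw (Rmin_l _ _))).
specialize (H' w (Rlt_le_trans _ _ _ Hw (Rmin_r _ _))).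
replace (f w * g w - f z * g z) with
  ((f w - f z) * (g w - g z) + (f z * (g w - g z) + g z * (f w - f z))) by ring.
apply Rle_lt_trans with (1 := Cmod_triangle _ _).
assert (T := Cmod_triangle (f z * (g w - g z)) (g z * (f w - f z))).
rewrite !Cmod_mult in *. unfold m in He2.
assert (P1 := Cmod_ge_0 (f w - f z)). assert (P2 := Cmod_ge_0 (g w - g z)).
assert (Q1 : (Cmod (f w - f z) * Cmod (g w - g z) < eta)%R) by nra.
nra.
Qed.

Lemma Ccont_const (k z : C) : Ccont (fun _ => k) z.
Proof.
intros eps Heps. exists 1%R; split; [lra|]. intros w _.
replace (k - k) with (RtoC 0) by ring. now rewrite Cmod_0.
Qed.

Lemma Ccont_pow (f : C -> C) (z : C) (n : nat) : Ccont f z -> Ccont (fun w => f w ^ n) z.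
Proof.
intros Hf. induction n as [|n IH]; simpl; [apply Ccont_const|now apply Ccont_mult].
Qed.

Lemma Ccont_path (f : C -> C) (a b : C) (t : R) : Ccont f (a + t * b)%C ->
  forall eps : R, (0 < eps)%R -> exists d : R, (0 < d)%R /\ forall s : R,
    (Rabs (s - t) < d)%R -> (Cmod (f (a + s * b) - f (a + t * b))%C < eps)%R.
Proof.
intros H eps Heps. destruct (H eps Heps) as [d [Hd0 H']].
assert (Hb0 := Cmod_ge_0 b).
exists (d / (1 + Cmod b))%R; split; [apply Rdiv_lt_0_compat; lra|].
intros s Hs. apply H'.
replace (a + s * b - (a + t * b)) with ((s - t)%R * b) by (rewrite RtoC_minus; ring).
rewrite Cmod_mult, Cmod_R.
apply Rmult_lt_compat_r with (r := (1 + Cmod b)%R) in Hs; [|lra].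
replace (d / (1 + Cmod b) * (1 + Cmod b))%R with d in Hs by (field; lra).
assert (Hp := Rabs_pos (s - t)). nra.
Qed.

Lemma continuity_pt_Re_path (f : C -> C) (a b : C) (t : R) :
  Ccont f (a + t * b)%C -> continuity_pt (fun t : R => Re (f (a + t * b))) t.
Proof.
intros H eps Heps. destruct (Ccont_path f a b t H eps Heps) as [d [Hd0 H']].
exists d; split; [exact Hd0|].
intros s [_ Hs]. simpl in Hs |- *. unfold R_dist in *.
apply Rle_lt_trans with (2 := H' s Hs).
apply Rle_trans with (2 := re_le_Cmod _). right. reflexivity.
Qed.

Lemma Re_conj_mult (z : C) : Re (Cconj z * z) = (Cmod z * Cmod z)%R.
Proof.
replace (Cmod z * Cmod z)%R with (Cmod z ^ 2)%R by ring.
rewrite Cmod2_alt. unfold Re, Im; simpl; ring.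
Qed.

(** With X the quantity to be bounded, the real mean value theorem applied to Re (conj X (f w - (w -
    a) L)) along the segment gives |X|^2 <= |X| |b| M. Mere continuity at the end points lets
    [slope_log_derivative] start from a point where the derivative is still unknown. *)
Lemma C_mean_value (f df : C -> C) (L a b : C) (M : R) :
  Ccont f a -> Ccont f (a + b) ->
  (forall t : R, (0 < t < 1)%R -> Cdiff f (a + t * b)%C (df (a + t * b)%C)) ->
  (forall t : R, (0 <= t <= 1)%R -> (Cmod (df (a + t * b) - L)%C <= M)%R) ->
  (Cmod (f (a + b) - f a - b * L)%C <= M * Cmod b)%R.
Proof.
intros Ca Cb Hd HM.
set (X := f (a + b) - f a - b * L).
set (k := Cconj X).
set (g := fun w => k * (f w + - ((w - a) * L))).
assert (Hlin : forall w, Cdiff (fun w => - ((w - a) * L)) w (- L)).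
{ intros w. eapply Cdiff_eq.
  - apply Cdiff_opp, Cdiff_mult; [|apply Cdiff_const].
    apply Cdiff_minus; [apply Cdiff_id|apply Cdiff_const].
  - cbv beta. ring. }
destruct (MVT_gen (fun t : R => Re (g (a + t * b))) 0 1
   (fun t => Re (b * (k * (df (a + t * b)%C - L))))) as [t [Ht E]].
{ rewrite Rmin_left, Rmax_right by lra.
  intros t Ht. apply is_derive_Re_path. unfold g.
  eapply Cdiff_eq.
  - apply Cdiff_mult; [apply Cdiff_const|]. apply Cdiff_plus; [now apply Hd|apply Hlin].
  - cbv beta. ring. }
{ rewrite Rmin_left, Rmax_right by lra. intros t Ht.
  apply continuity_pt_Re_path, Ccont_scal, Ccont_plus; [|eapply Cdiff_cont, Hlin].
  destruct (Req_dec t 0) as [->|H0].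
  { replace (a + 0 * b) with a by ring. exact Ca. }
  destruct (Req_dec t 1) as [->|H1].
  { replace (a + 1 * b) with (a + b) by ring. exact Cb. }
  eapply Cdiff_cont. apply Hd. lra. }
rewrite Rmin_left, Rmax_right in Ht by lra.
rewrite Rminus_0_r, Rmult_1_r in E.
replace (Re (g (a + 1%R * b)%C) - Re (g (a + 0%R * b)%C))%R with (Re (k * X)%C) in E.
2:{ unfold g. replace (a + 1 * b) with (a + b) by ring. replace (a + 0 * b) with a by ring.
  unfold X, Re; simpl; ring. }
unfold k in E. rewrite Re_conj_mult in E.
assert (H1 := Re_le_Cmod (b * (Cconj X * (df (a + t * b)%C - L)))).
rewrite <- E, !Cmod_mult, Cmod_conj in H1.
assert (H2 := HM t Ht).
destruct (Rle_lt_or_eq_dec 0 (Cmod X) (Cmod_ge_0 X)) as [HX|HX].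
- apply Rmult_le_reg_l with (Cmod X); [exact HX|].
  apply Rle_trans with (1 := H1).
  replace (Cmod X * (M * Cmod b))%R with (Cmod b * (Cmod X * M))%R by ring.
  apply Rmult_le_compat_l; [apply Cmod_ge_0|]. apply Rmult_le_compat_l; lra.
- rewrite <- HX. apply Rmult_le_pos; [|apply Cmod_ge_0].
  apply Rle_trans with (2 := H2), Cmod_ge_0.
Qed.

(** * Bisection and compactness *)

(** Every left end lies below every right end, as comparison with the interval of index n + m shows;
    the supremum of the left ends is the common point. *)
Lemma nested_intervals (x l : nat -> R) :
  (forall n, (0 <= l n)%R) -> (forall n, (x n <= x (S n))%R) ->
  (forall n, (x (S n) + l (S n) <= x n + l n)%R) ->
  exists a : R, forall n, (x n <= a <= x n + l n)%R.
Proof.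
intros Hl Hx Hy.
assert (Mx : forall n k, (x n <= x (n + k)%nat)%R).
{ intros n k; induction k as [|k IH].
  - rewrite Nat.add_0_r; lra.
  - rewrite Nat.add_succ_r. specialize (Hx (n + k)%nat); lra. }
assert (My : forall n k, (x (n + k)%nat + l (n + k)%nat <= x n + l n)%R).
{ intros n k; induction k as [|k IH].
  - rewrite Nat.add_0_r; lra.
  - rewrite Nat.add_succ_r. specialize (Hy (n + k)%nat); lra. }
assert (Mxy : forall n m, (x n <= x m + l m)%R).
{ intros n m. assert (H1 := Mx n m). assert (H2 := My m n).
  rewrite Nat.add_comm in H2. specialize (Hl (n + m)%nat). lra. }
destruct (completeness (fun r => exists n, r = x n)) as [a [Hub Hlub]].
- exists (x 0%nat + l 0%nat)%R. intros r [n ->]. apply Mxy.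
- exists (x 0%nat), 0%nat; reflexivity.
- exists a. intros n; split.
  + apply Hub. now exists n.
  + apply Hlub. intros r [m ->]. apply Mxy.
Qed.

(** The common engine of [compact_max] and of Goursat's theorem: a good quarter is chosen at each
    step and the nested squares shrink to a point. *)
Lemma square_bisection (P : R -> R -> R -> Prop) (x0 y0 l0 : R) :
  (0 < l0)%R -> P x0 y0 l0 ->
  (forall x y l, (0 < l)%R -> P x y l ->
    P x y (l / 2)%R \/ P (x + l / 2)%R y (l / 2)%R \/
    P x (y + l / 2)%R (l / 2)%R \/ P (x + l / 2)%R (y + l / 2)%R (l / 2)%R) ->
  exists a b : R, forall d : R, (0 < d)%R -> exists x y l : R,
    (0 < l < d)%R /\ (x <= a <= x + l)%R /\ (y <= b <= y + l)%R /\ P x y l.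
Proof.
intros Hl0 H0 Hstep.
set (l := fun n : nat => (l0 / 2 ^ n)%R).
assert (Hp2 : forall n : nat, (0 < 2 ^ n)%R) by (intros n; apply pow_lt; lra).
assert (Hl : forall n, (0 < l n)%R) by (intros n; apply Rdiv_lt_0_compat; auto).
assert (HlS : forall n, l (S n) = (l n / 2)%R).
{ intros n. unfold l. simpl. specialize (Hp2 n). field. lra. }
(* The premise on [P] sits under the existential so that the recursion defining [z] is total; where
   [P] fails, the corner itself is a dummy witness. *)
assert (Hex : forall (n : nat) (z : R * R), exists w : R * R,
  P (fst z) (snd z) (l n) ->
  P (fst w) (snd w) (l (S n)) /\ (fst z <= fst w)%R /\ (snd z <= snd w)%R /\
  (fst w + l (S n) <= fst z + l n)%R /\ (snd w + l (S n) <= snd z + l n)%R).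
{ intros n [x y]. rewrite HlS. assert (Hn := Hl n).
  destruct (classic (P x y (l n))) as [HP|HP].
  2:{ exists (x, y). simpl. tauto. }
  destruct (Hstep x y (l n) Hn HP) as [H|[H|[H|H]]];
  eexists (_, _); intros _; simpl; (split; [exact H|]); lra. }
set (z := fix z (n : nat) : R * R := match n with
  | O => (x0, y0)
  | S n => proj1_sig (constructive_indefinite_description _ (Hex n (z n))) end).
assert (Hz : forall n, P (fst (z n)) (snd (z n)) (l n)).
{ induction n as [|n IH]; simpl.
  - unfold l. simpl. now rewrite Rdiv_1_r.
  - destruct constructive_indefinite_description as [w Hw]; simpl. now apply Hw. }
assert (Hs : forall n, (fst (z n) <= fst (z (S n)))%R /\ (snd (z n) <= snd (z (S n)))%R /\
  (fst (z (S n)) + l (S n) <= fst (z n) + l n)%R /\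
  (snd (z (S n)) + l (S n) <= snd (z n) + l n)%R).
{ intros n. simpl. destruct constructive_indefinite_description as [w Hw]; simpl.
  apply Hw, Hz. }
destruct (nested_intervals (fun n => fst (z n)) l) as [a Ha];
  [intros n; apply Rlt_le, Hl | intros n; apply Hs | intros n; apply Hs |].
destruct (nested_intervals (fun n => snd (z n)) l) as [b Hb];
  [intros n; apply Rlt_le, Hl | intros n; apply Hs | intros n; apply Hs |].
exists a, b. intros d Hd.
destruct (pow_lt_1_zero (/ 2)) with (y := (d / l0)%R) as [n Hn].
{ rewrite Rabs_pos_eq; lra. }
{ now apply Rdiv_lt_0_compat. }
exists (fst (z n)), (snd (z n)), (l n). split; [|split; [apply Ha|split; [apply Hb|apply Hz]]].
split; [apply Hl|].
specialize (Hn n (Nat.le_refl n)).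
rewrite Rabs_pos_eq, pow_inv in Hn.
2:{ apply pow_le; lra. }
unfold l. apply Rmult_lt_compat_l with (r := l0) in Hn; [|exact Hl0].
replace (l0 * (d / l0))%R with d in Hn by (field; lra). exact Hn.
Qed.

Lemma Cmod_le_Rabs (z : C) : (Cmod z <= Rabs (fst z) + Rabs (snd z))%R.
Proof.
replace z with (RtoC (fst z) + Ci * RtoC (snd z)) at 1.
- apply Rle_trans with (1 := Cmod_triangle _ _).
  rewrite Cmod_mult, Cmod_Ci, !Cmod_R. lra.
- destruct z as [x y]. apply injective_projections; simpl; ring.
Qed.

Lemma Cmod_in_square (x y l : R) (z w : C) :
  (x <= fst z <= x + l)%R -> (y <= snd z <= y + l)%R ->
  (x <= fst w <= x + l)%R -> (y <= snd w <= y + l)%R -> (Cmod (w - z) <= 2 * l)%R.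
Proof.
intros H1 H2 H3 H4. apply Rle_trans with (1 := Cmod_le_Rabs _). simpl.
assert (Rabs (fst w + - fst z) <= l)%R by (apply Rabs_le; lra).
assert (Rabs (snd w + - snd z) <= l)%R by (apply Rabs_le; lra). lra.
Qed.

(** Bisection with the property that each value of u on K is matched or exceeded on K within the
    square. If it failed on all four quarters, the largest of the four counterexamples would exceed
    every value in the square. Closedness puts the limit point in K, and upper semicontinuity makes
    it a maximum. *)
Lemma compact_max (K : C -> Prop) (u : C -> R) (B : R) :
  (exists z, K z) -> (forall z, K z -> (Cmod z <= B)%R) ->
  (forall z, (forall d, (0 < d)%R -> exists w, K w /\ (Cmod (w - z) < d)%R) -> K z) ->
  (forall z, K z -> forall eps, (0 < eps)%R -> exists d, (0 < d)%R /\
     forall w, K w -> (Cmod (w - z) < d)%R -> (u w < u z + eps)%R) ->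
  exists z, K z /\ forall w, K w -> (u w <= u z)%R.
Proof.
intros [k0 Hk0] HB Hcl Hu.
assert (HB0 : (0 <= B)%R) by (apply Rle_trans with (2 := HB k0 Hk0), Cmod_ge_0).
set (inQ := fun (x y l : R) (w : C) => (x <= fst w <= x + l)%R /\ (y <= snd w <= y + l)%R).
set (P := fun x y l => forall w, K w -> exists w', K w' /\ inQ x y l w' /\ (u w <= u w')%R).
assert (HnP : forall x y l, ~ P x y l -> exists w, K w /\
  forall w', K w' -> inQ x y l w' -> (u w' < u w)%R).
{ intros x y l H. apply not_all_ex_not in H as [w H].
  apply imply_to_and in H as [Hw H]. exists w; split; [exact Hw|].
  intros w' Hw' Hq. apply Rnot_le_lt. intros Hle. apply H. now exists w'. }
destruct (square_bisection P (- (B + 1)) (- (B + 1)) (2 * (B + 1))) as [a [b Hab]].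
- lra.
- intros w Hw. exists w; split; [exact Hw|]. split; [|lra].
  assert (H := HB w Hw). assert (H1 := Rmax_Cmod w).
  assert (H2 := Rmax_l (Rabs (fst w)) (Rabs (snd w))).
  assert (H3 := Rmax_r (Rabs (fst w)) (Rabs (snd w))).
  assert (H4 := proj1 (Rabs_le_between (fst w) B)).
  assert (H5 := proj1 (Rabs_le_between (snd w) B)).
  unfold inQ. lra.
- intros x y l Hl HP. apply NNPP. intros Hn.
  apply not_or_and in Hn as [N1 Hn]. apply not_or_and in Hn as [N2 Hn].
  apply not_or_and in Hn as [N3 N4].
  apply HnP in N1 as [w1 [K1 N1]]. apply HnP in N2 as [w2 [K2 N2]].
  apply HnP in N3 as [w3 [K3 N3]]. apply HnP in N4 as [w4 [K4 N4]].
  assert (Hm : exists w, K w /\ (u w1 <= u w /\ u w2 <= u w /\ u w3 <= u w /\ u w4 <= u w)%R).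
  { assert (H2 : forall p q : C, K p -> K q -> exists m, K m /\ (u p <= u m /\ u q <= u m)%R).
    { intros p q Hp Hq. destruct (Rle_dec (u p) (u q)); [exists q | exists p]; split; trivial; lra. }
    destruct (H2 w1 w2 K1 K2) as [m1 [M1 I1]]. destruct (H2 w3 w4 K3 K4) as [m2 [M2 I2]].
    destruct (H2 m1 m2 M1 M2) as [m [M I]]. exists m; split; trivial; lra. }
  destruct Hm as [w [Kw Iw]]. destruct (HP w Kw) as [w' [Kw' [[Hx Hy] Hle]]].
  destruct (Rle_dec (fst w') (x + l / 2)); destruct (Rle_dec (snd w') (y + l / 2)).
  + assert (u w' < u w1)%R by (apply N1; [exact Kw'|unfold inQ; lra]). lra.
  + assert (u w' < u w3)%R by (apply N3; [exact Kw'|unfold inQ; lra]). lra.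
  + assert (u w' < u w2)%R by (apply N2; [exact Kw'|unfold inQ; lra]). lra.
  + assert (u w' < u w4)%R by (apply N4; [exact Kw'|unfold inQ; lra]). lra.
- set (z := (a, b) : C).
  assert (Hz : forall w d, K w -> (0 < d)%R -> exists w', K w' /\ (Cmod (w' - z) < d)%R /\
    (u w <= u w')%R).
  { intros w d Hw Hd. destruct (Hab (d / 2)%R) as [x [y [l [Hl [Hx [Hy HP]]]]]]; [lra|].
    destruct (HP w Hw) as [w' [Kw' [[Hx' Hy'] Hle]]].
    exists w'; split; [exact Kw'|split; [|exact Hle]].
    apply Rle_lt_trans with (2 * l)%R; [|lra].
    now apply (Cmod_in_square x y). }
  assert (Kz : K z).
  { apply Hcl. intros d Hd. destruct (Hz k0 d Hk0 Hd) as [w' H]. now exists w'. }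
  exists z; split; [exact Kz|]. intros w Hw. apply Rnot_lt_le. intros Hlt.
  destruct (Hu z Kz (u w - u z)%R) as [d [Hd H]]; [lra|].
  destruct (Hz w d Hw Hd) as [w' [Kw' [Hw' Hle]]].
  specialize (H w' Kw' Hw'). lra.
Qed.

(** * Goursat's theorem on squares *)

Lemma RInt_Rminus (f g : R -> R) (a b : R) : ex_RInt f a b -> ex_RInt g a b ->
  RInt (fun t => f t - g t)%R a b = (RInt f a b - RInt g a b)%R.
Proof. exact (RInt_minus (V := R_CompleteNormedModule) f g a b). Qed.

Lemma ex_RInt_Rminus (f g : R -> R) (a b : R) : ex_RInt f a b -> ex_RInt g a b ->
  ex_RInt (fun t => f t - g t)%R a b.
Proof. exact (ex_RInt_minus (V := R_NormedModule) f g a b). Qed.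

Lemma RInt_Rconst (k a b : R) : RInt (fun _ => k) a b = ((b - a) * k)%R.
Proof. exact (RInt_const (V := R_CompleteNormedModule) a b k). Qed.

Lemma RInt_near_const (f : R -> R) (a b k M : R) :
  (a <= b)%R -> ex_RInt f a b -> (forall t, (a <= t <= b)%R -> (Rabs (f t - k) <= M)%R) ->
  (Rabs (RInt f a b - (b - a) * k) <= (b - a) * M)%R.
Proof.
intros Hab Hf HM.
assert (Hk := ex_RInt_const (V := R_NormedModule) a b k).
assert (H := abs_RInt_le_const _ a b M Hab (ex_RInt_Rminus _ _ _ _ Hf Hk) HM).
rewrite RInt_Rminus, RInt_Rconst in H by assumption. exact H.
Qed.

(** Im (H dz) is Im H dt on a horizontal side, where dz = dt, and Re H dt on a vertical one, where
    dz = i dt. The imaginary part is the useful one: its vertical sides become circular means of the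
    real part of a function. *)
Definition hor (H : C -> C) (y a b : R) : R := RInt (fun t => Im (H (t, y))) a b.
Definition ver (H : C -> C) (x a b : R) : R := RInt (fun t => Re (H (x, t))) a b.

(* The imaginary part of the contour integral of [H] along the square. *)
Definition circ (H : C -> C) (x y l : R) : R :=
  (hor H y x (x + l) + ver H (x + l) y (y + l) - hor H (y + l) x (x + l) - ver H x y (y + l))%R.

Lemma ex_RInt_hor (H : C -> C) (y a b : R) : (a <= b)%R ->
  (forall t, (a <= t <= b)%R -> Ccont H (t, y)) -> ex_RInt (fun t => Im (H (t, y))) a b.
Proof.
intros Hab Hc. apply (ex_RInt_continuous (V := R_CompleteNormedModule)).
rewrite Rmin_left, Rmax_right by exact Hab. intros t Ht.
apply continuity_pt_filterlim. intros eps Heps.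
destruct (Hc t Ht eps Heps) as [d [Hd H']]. exists d; split; [exact Hd|].
intros s [_ Hs]. simpl in *. unfold R_dist in *.
apply Rle_lt_trans with (Cmod (H (s, y) - H (t, y))).
- apply Rle_trans with (2 := Rmax_Cmod _), Rmax_r.
- apply H'. apply Rle_lt_trans with (1 := Cmod_le_Rabs _). simpl.
  replace (y + - y)%R with 0%R by ring. rewrite Rabs_R0. unfold Rminus in Hs. lra.
Qed.

Lemma ex_RInt_ver (H : C -> C) (x a b : R) : (a <= b)%R ->
  (forall t, (a <= t <= b)%R -> Ccont H (x, t)) -> ex_RInt (fun t => Re (H (x, t))) a b.
Proof.
intros Hab Hc. apply (ex_RInt_continuous (V := R_CompleteNormedModule)).
rewrite Rmin_left, Rmax_right by exact Hab. intros t Ht.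
apply continuity_pt_filterlim. intros eps Heps.
destruct (Hc t Ht eps Heps) as [d [Hd H']]. exists d; split; [exact Hd|].
intros s [_ Hs]. simpl in *. unfold R_dist in *.
apply Rle_lt_trans with (Cmod (H (x, s) - H (x, t))).
- apply Rle_trans with (2 := Rmax_Cmod _), Rmax_l.
- apply H'. apply Rle_lt_trans with (1 := Cmod_le_Rabs _). simpl.
  replace (x + - x)%R with 0%R by ring. rewrite Rabs_R0. unfold Rminus in Hs. lra.
Qed.

Lemma hor_Chasles (H : C -> C) (y a b c : R) : (a <= b)%R -> (b <= c)%R ->
  (forall t, (a <= t <= c)%R -> Ccont H (t, y)) -> (hor H y a c = hor H y a b + hor H y b c)%R.
Proof.
intros Hab Hbc Hc. symmetry. apply (RInt_Chasles (V := R_CompleteNormedModule));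
apply ex_RInt_hor; try assumption; intros t Ht; apply Hc; lra.
Qed.

Lemma ver_Chasles (H : C -> C) (x a b c : R) : (a <= b)%R -> (b <= c)%R ->
  (forall t, (a <= t <= c)%R -> Ccont H (x, t)) -> (ver H x a c = ver H x a b + ver H x b c)%R.
Proof.
intros Hab Hbc Hc. symmetry. apply (RInt_Chasles (V := R_CompleteNormedModule));
apply ex_RInt_ver; try assumption; intros t Ht; apply Hc; lra.
Qed.

Definition in_square (x y l : R) (z : C) : Prop :=
  (x <= fst z <= x + l)%R /\ (y <= snd z <= y + l)%R.

(** The inner sides are run through twice, in opposite directions. *)
Lemma circ_quarters (H : C -> C) (x y l : R) : (0 < l)%R ->
  (forall z, in_square x y l z -> Ccont H z) ->
  circ H x y l = (circ H x y (l / 2) + circ H (x + l / 2) y (l / 2) +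
    circ H x (y + l / 2) (l / 2) + circ H (x + l / 2) (y + l / 2) (l / 2))%R.
Proof.
intros Hl Hc. unfold circ.
replace (x + l / 2 + l / 2)%R with (x + l)%R by field.
replace (y + l / 2 + l / 2)%R with (y + l)%R by field.
rewrite (hor_Chasles H y x (x + l / 2) (x + l)), (hor_Chasles H (y + l) x (x + l / 2) (x + l)),
  (ver_Chasles H x y (y + l / 2) (y + l)), (ver_Chasles H (x + l) y (y + l / 2) (y + l));
try lra; intros t Ht; apply Hc; unfold in_square; simpl; lra.
Qed.

(* On a small square around a point where [H] has derivative [D], the affine part of [H]
   contributes [- l^2 Re D] through the horizontal sides and [l^2 Re D] through the others. *)
Lemma circ_local (H : C -> C) (z D : C) (eps : R) : Cdiff H z D -> (0 < eps)%R ->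
  exists d, (0 < d)%R /\ forall x y l, (0 < l < d)%R -> in_square x y l z ->
    (forall w, in_square x y l w -> Ccont H w) -> (Rabs (circ H x y l) <= eps * (l * l))%R.
Proof.
(* As |w - z| <= 2 l in the square, eps / 8 becomes eps / 4 for one value, eps / 2 for the
   difference of two opposite sides, and eps for the two pairs of sides. *)
intros HD Heps. destruct (proj1 (Cdiff_iff H z D) HD (eps / 8)%R) as [d [Hd H']]; [lra|].
exists (d / 2)%R; split; [lra|]. intros x y l Hl [Hzx Hzy] Hc.
set (e := fun w => H w - H z - (w - z) * D).
assert (He : forall w, in_square x y l w -> (Cmod (e w) <= eps / 4 * l)%R).
{ intros w [Hwx Hwy].
  assert (H2 := Cmod_in_square x y l z w Hzx Hzy Hwx Hwy).
  apply Rle_trans with (eps / 8 * Cmod (w - z))%R; [apply H'; lra|].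
  replace (eps / 4 * l)%R with (eps / 8 * (2 * l))%R by field.
  apply Rmult_le_compat_l; lra. }
assert (Hdiff : forall v w, in_square x y l v -> in_square x y l w ->
  (Cmod (H v - H w - (v - w) * D) <= eps / 2 * l)%R).
{ intros v w Hv Hw. replace (H v - H w - (v - w) * D) with (e v + - e w) by (unfold e; ring).
  apply Rle_trans with (1 := Cmod_triangle _ _). rewrite Cmod_opp.
  assert (H1 := He v Hv). assert (H2 := He w Hw). lra. }
assert (Eh : forall t, (x <= t <= x + l)%R ->
  (Rabs (Im (H (t, y)) - Im (H (t, (y + l)%R)) - - (l * Re D)) <= eps / 2 * l)%R).
{ intros t Ht. apply Rle_trans with (Cmod (H (t, y) - H (t, (y + l)%R) - ((t, y) - (t, (y + l)%R)) * D)).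
  - apply Rle_trans with (2 := Rmax_Cmod _), Rle_trans with (2 := Rmax_r _ _).
    right. f_equal. unfold Im, Re; simpl. ring.
  - apply Hdiff; unfold in_square; simpl; lra. }
assert (Ev : forall t, (y <= t <= y + l)%R ->
  (Rabs (Re (H ((x + l)%R, t)) - Re (H (x, t)) - (l * Re D)) <= eps / 2 * l)%R).
{ intros t Ht. apply Rle_trans with (Cmod (H ((x + l)%R, t) - H (x, t) - (((x + l)%R, t) - (x, t)) * D)).
  - apply Rle_trans with (2 := Rmax_Cmod _), Rle_trans with (2 := Rmax_l _ _).
    right. f_equal. unfold Im, Re; simpl. ring.
  - apply Hdiff; unfold in_square; simpl; lra. }
assert (X1 : ex_RInt (fun t => Im (H (t, y))) x (x + l)).
{ apply ex_RInt_hor; [lra|]. intros t Ht. apply Hc; unfold in_square; simpl; lra. }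
assert (X2 : ex_RInt (fun t => Im (H (t, (y + l)%R))) x (x + l)).
{ apply ex_RInt_hor; [lra|]. intros t Ht. apply Hc; unfold in_square; simpl; lra. }
assert (X3 : ex_RInt (fun t => Re (H ((x + l)%R, t))) y (y + l)).
{ apply ex_RInt_ver; [lra|]. intros t Ht. apply Hc; unfold in_square; simpl; lra. }
assert (X4 : ex_RInt (fun t => Re (H (x, t))) y (y + l)).
{ apply ex_RInt_ver; [lra|]. intros t Ht. apply Hc; unfold in_square; simpl; lra. }
assert (Ih := RInt_near_const _ x (x + l) _ _ ltac:(lra) (ex_RInt_Rminus _ _ _ _ X1 X2) Eh).
assert (Iv := RInt_near_const _ y (y + l) _ _ ltac:(lra) (ex_RInt_Rminus _ _ _ _ X3 X4) Ev).
rewrite RInt_Rminus in Ih by assumption. rewrite RInt_Rminus in Iv by assumption.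
fold (hor H y x (x + l)) (hor H (y + l) x (x + l)) in Ih.
fold (ver H (x + l) y (y + l)) (ver H x y (y + l)) in Iv.
replace (x + l - x)%R with l in Ih by ring. replace (y + l - y)%R with l in Iv by ring.
apply Rabs_le_between in Ih. apply Rabs_le_between in Iv.
unfold circ. apply Rabs_le. lra.
Qed.

(** If the integral were nonzero, the property that |circ| exceeds eps times the area would pass to
    some quarter at each step, and [circ_local] refutes it near the limit point. Taking for eps half
    of the initial ratio makes the first inequality strict. *)
Lemma circ_eq0 (H : C -> C) (x0 y0 l0 : R) : (0 < l0)%R ->
  (forall z, in_square x0 y0 l0 z -> exists D, Cdiff H z D) -> circ H x0 y0 l0 = 0%R.
Proof.
intros Hl0 HD. apply NNPP. intros Hne.
assert (Hc : forall z, in_square x0 y0 l0 z -> Ccont H z).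
{ intros z Hz. destruct (HD z Hz) as [D HDz]. eapply Cdiff_cont, HDz. }
set (eps := (Rabs (circ H x0 y0 l0) / (2 * (l0 * l0)))%R).
assert (Heps : (0 < eps)%R).
{ apply Rdiv_lt_0_compat; [now apply Rabs_pos_lt|]. nra. }
set (P := fun x y l => (x0 <= x)%R /\ (x + l <= x0 + l0)%R /\ (y0 <= y)%R /\ (y + l <= y0 + l0)%R /\
   (eps * (l * l) < Rabs (circ H x y l))%R).
destruct (square_bisection P x0 y0 l0 Hl0) as [a [b Hab]].
- unfold P. repeat (split; [lra|]).
  assert (0 < Rabs (circ H x0 y0 l0))%R by now apply Rabs_pos_lt.
  unfold eps. replace (Rabs (circ H x0 y0 l0) / (2 * (l0 * l0)) * (l0 * l0))%R with
    (Rabs (circ H x0 y0 l0) / 2)%R by (field; lra). lra.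
- intros x y l Hl [Hx1 [Hx2 [Hy1 [Hy2 HP]]]].
  rewrite (circ_quarters H x y l Hl) in HP.
  2:{ intros z [Hz1 Hz2]. apply Hc. split; lra. }
  set (c1 := circ H x y (l / 2)) in *. set (c2 := circ H (x + l / 2) y (l / 2)) in *.
  set (c3 := circ H x (y + l / 2) (l / 2)) in *.
  set (c4 := circ H (x + l / 2) (y + l / 2) (l / 2)) in *.
  assert (T1 := Rabs_triang (c1 + c2 + c3) c4). assert (T2 := Rabs_triang (c1 + c2) c3).
  assert (T3 := Rabs_triang c1 c2).
  set (q := (eps * (l / 2 * (l / 2)))%R).
  assert (Hq : (eps * (l * l) = 4 * q)%R) by (unfold q; field).
  rewrite Hq in HP. unfold P. fold c1 c2 c3 c4 q.
  destruct (Rlt_dec q (Rabs c1)); [left; lra|right].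
  destruct (Rlt_dec q (Rabs c2)); [left; lra|right].
  destruct (Rlt_dec q (Rabs c3)); [left; lra|right]. lra.
- assert (Hin : in_square x0 y0 l0 (a, b)).
  { destruct (Hab 1%R Rlt_0_1) as [x [y [l [Hl [Hx [Hy HP]]]]]]. unfold P in HP.
    unfold in_square; simpl; lra. }
  destruct (HD _ Hin) as [D HDz].
  destruct (circ_local H (a, b) D eps HDz Heps) as [d [Hd Hloc]].
  destruct (Hab d Hd) as [x [y [l [Hl [Hx [Hy [Hx1 [Hx2 [Hy1 [Hy2 HP]]]]]]]]]].
  specialize (Hloc x y l Hl (conj Hx Hy)).
  assert (Rabs (circ H x y l) <= eps * (l * l))%R; [|lra].
  apply Hloc. intros w [Hw1 Hw2]. apply Hc. split; lra.
Qed.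

(** * Maximum modulus principle *)

Definition Cexp (w : C) : C := ((exp (fst w) * cos (snd w))%R, (exp (fst w) * sin (snd w))%R).

Lemma Cexp_plus (z w : C) : Cexp (z + w) = Cexp z * Cexp w.
Proof.
unfold Cexp; simpl. rewrite exp_plus, cos_plus, sin_plus.
apply injective_projections; simpl; ring.
Qed.

Lemma Cmod_Cexp (w : C) : Cmod (Cexp w) = exp (fst w).
Proof.
apply Rsqr_inj; [apply Cmod_ge_0 | apply Rlt_le, exp_pos|].
rewrite !Rsqr_pow2, Cmod2_alt. unfold Cexp, Re, Im; simpl.
assert (H := sin2_cos2 (snd w)). unfold Rsqr in H.
replace (exp (fst w) * (exp (fst w) * 1))%R with
  (exp (fst w) * exp (fst w) * (sin (snd w) * sin (snd w) + cos (snd w) * cos (snd w)))%R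
  by (rewrite H; ring). ring.
Qed.

Lemma derivable_pt_lim_0_bound (f : R -> R) (l eps : R) : derivable_pt_lim f 0 l -> (0 < eps)%R ->
  exists d, (0 < d)%R /\ forall x, (Rabs x < d)%R -> (Rabs (f x - f 0%R - l * x) <= eps * Rabs x)%R.
Proof.
intros H Heps. destruct (H eps Heps) as [d Hd]. exists d; split; [apply cond_pos|].
intros x Hx. destruct (Req_dec x 0) as [->|Hx0].
- replace (f 0 - f 0 - l * 0)%R with 0%R by ring. rewrite Rabs_R0. lra.
- specialize (Hd x Hx0 Hx). rewrite Rplus_0_l in Hd.
  replace (f x - f 0 - l * x)%R with (((f x - f 0) / x - l) * x)%R by (field; exact Hx0).
  rewrite Rabs_mult. apply Rmult_le_compat_r; [apply Rabs_pos|lra].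
Qed.

(** The functional equation moves the question to 0, where it reduces to the first-order expansions
    of exp, cos and sin. *)
Lemma Cdiff_Cexp (z : C) : Cdiff Cexp z (Cexp z).
Proof.
apply Cdiff_iff. intros eps Heps.
assert (Hz := exp_pos (fst z)). rewrite <- Cmod_Cexp in Hz.
(* The 8 is 1 + 2 + 4 + 1, the sum of the bounds [Q1] to [Q4] below in units of eta m. *)
set (eta := Rmin 1 (eps / (8 * Cmod (Cexp z)))).
assert (Heta : (0 < eta)%R).
{ apply Rmin_pos; [lra|]. apply Rdiv_lt_0_compat; lra. }
assert (He1 : (eta <= 1)%R) by apply Rmin_l.
assert (He2 : (8 * eta * Cmod (Cexp z) <= eps)%R).
{ assert (H : (eta <= eps / (8 * Cmod (Cexp z)))%R) by apply Rmin_r.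
  apply Rmult_le_compat_r with (r := (8 * Cmod (Cexp z))%R) in H; [|lra].
  replace (eps / (8 * Cmod (Cexp z)) * (8 * Cmod (Cexp z)))%R with eps in H by (field; lra).
  lra. }
destruct (derivable_pt_lim_0_bound exp 1 eta derivable_pt_lim_exp_0 Heta) as [d1 [D1 B1]].
destruct (derivable_pt_lim_0_bound cos 0 eta) as [d2 [D2 B2]]; [|exact Heta|].
{ replace 0%R with (- sin 0)%R at 2 by (rewrite sin_0; ring). apply derivable_pt_lim_cos. }
destruct (derivable_pt_lim_0_bound sin 1 eta) as [d3 [D3 B3]]; [|exact Heta|].
{ replace 1%R with (cos 0)%R by apply cos_0. apply derivable_pt_lim_sin. }
rewrite exp_0 in B1. rewrite cos_0 in B2. rewrite sin_0 in B3.
exists (Rmin eta (Rmin d1 (Rmin d2 d3))); split.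
{ apply Rmin_pos; [assumption|]. repeat apply Rmin_pos; assumption. }
intros w Hw. set (k := w - z) in *.
assert (Ew : w = z + k) by (unfold k; ring).
assert (K1 : (Rabs (fst k) <= Cmod k)%R) by (apply Rle_trans with (2 := Rmax_Cmod k), Rmax_l).
assert (K2 : (Rabs (snd k) <= Cmod k)%R) by (apply Rle_trans with (2 := Rmax_Cmod k), Rmax_r).
assert (L0 := Rmin_l eta (Rmin d1 (Rmin d2 d3))). assert (L1 := Rmin_r eta (Rmin d1 (Rmin d2 d3))).
assert (L2 := Rmin_l d1 (Rmin d2 d3)). assert (L3 := Rmin_r d1 (Rmin d2 d3)).
assert (L4 := Rmin_l d2 d3). assert (L5 := Rmin_r d2 d3).
rewrite Ew, Cexp_plus.
replace (Cexp z * Cexp k - Cexp z - k * Cexp z) with (Cexp z * (Cexp k - 1 - k)) by ring.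
rewrite Cmod_mult.
assert (Hk : (Cmod (Cexp k - 1 - k) <= 8 * eta * Cmod k)%R).
{ apply Rle_trans with (1 := Cmod_le_Rabs _). destruct k as [x y]. simpl fst in *; simpl snd in *.
  specialize (B1 x ltac:(lra)). specialize (B2 y ltac:(lra)). specialize (B3 y ltac:(lra)).
  set (m := Cmod (x, y)) in *.
  replace (exp x * cos y + - (1) + - x)%R with
    ((exp x - 1 - 1 * x) * cos y + (1 + x) * (cos y - 1 - 0 * y))%R by ring.
  replace (exp x * sin y + - 0 + - y)%R with
    ((exp x - 1) * sin y + (sin y - 0 - 1 * y))%R by ring.
  assert (Hc : (Rabs (cos y) <= 1)%R) by (apply Rabs_le, COS_bound).
  assert (P1 := Rabs_pos x). assert (P2 := Rabs_pos y).
  assert (A1 : (Rabs (exp x - 1) <= 2 * m)%R).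
  { replace (exp x - 1)%R with ((exp x - 1 - 1 * x) + x)%R by ring.
    apply Rle_trans with (1 := Rabs_triang _ _). nra. }
  assert (A2 : (Rabs (sin y) <= 2 * m)%R).
  { replace (sin y) with ((sin y - 0 - 1 * y) + y)%R by ring.
    apply Rle_trans with (1 := Rabs_triang _ _). nra. }
  assert (A3 : (Rabs (1 + x) <= 2)%R).
  { apply Rle_trans with (1 := Rabs_triang _ _). rewrite Rabs_R1. lra. }
  assert (Q1 : (Rabs ((exp x - 1 - 1 * x) * cos y) <= eta * m)%R).
  { rewrite Rabs_mult. assert (T := Rabs_pos (exp x - 1 - 1 * x)). nra. }
  assert (Q2 : (Rabs ((1 + x) * (cos y - 1 - 0 * y)) <= 2 * (eta * m))%R).
  { rewrite Rabs_mult. apply Rmult_le_compat; try apply Rabs_pos; [exact A3|nra]. }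
  assert (Q3 : (Rabs ((exp x - 1) * sin y) <= 4 * (eta * m))%R).
  { rewrite Rabs_mult. apply Rle_trans with ((2 * m) * (2 * m))%R.
    - apply Rmult_le_compat; try apply Rabs_pos; assumption.
    - nra. }
  assert (Q4 : (Rabs (sin y - 0 - 1 * y) <= eta * m)%R) by nra.
  assert (T1 := Rabs_triang ((exp x - 1 - 1 * x) * cos y) ((1 + x) * (cos y - 1 - 0 * y))).
  assert (T2 := Rabs_triang ((exp x - 1) * sin y) (sin y - 0 - 1 * y)). lra. }
assert (0 <= Cmod k)%R by apply Cmod_ge_0.
apply Rle_trans with (Cmod (Cexp z) * (8 * eta * Cmod k))%R.
- apply Rmult_le_compat_l; lra.
- replace (Cmod (Cexp z) * (8 * eta * Cmod k))%R with (8 * eta * Cmod (Cexp z) * Cmod k)%R by ring.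
  apply Rmult_le_compat_r; lra.
Qed.

(* Cauchy's theorem in logarithmic polar coordinates [z = z0 + exp (x + i y)]: by periodicity
   the sides [y = 0] and [y = 2 PI] cancel, so the circular means do not depend on the radius. *)
Lemma circular_mean_step (f : C -> C) (z0 : C) (s : R) :
  (forall z, (Cmod (z - z0) <= exp s)%R -> exists D, Cdiff f z D) ->
  ver (fun w => f (z0 + Cexp w)) (s - 2 * PI) 0 (2 * PI) =
  ver (fun w => f (z0 + Cexp w)) s 0 (2 * PI).
Proof.
intros Hf. set (H := fun w => f (z0 + Cexp w)). assert (Hpi := PI_RGT_0).
(* The height must be a full period; since [circ] is about squares, the width is 2 PI too, and one
   step divides the radius by exp (2 PI). *)
assert (Hc : circ H (s - 2 * PI) 0 (2 * PI) = 0%R).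
{ apply circ_eq0; [lra|]. intros z [Hz _].
  destruct (Hf (z0 + Cexp z)) as [D HD].
  - replace (z0 + Cexp z - z0) with (Cexp z) by ring. rewrite Cmod_Cexp.
    destruct (Rle_lt_or_eq_dec (fst z) s) as [Hlt| ->]; [lra| |lra].
    now apply Rlt_le, exp_increasing.
  - eexists. apply (Cdiff_comp f (fun w => z0 + Cexp w)); [exact HD|].
    apply Cdiff_plus; [apply Cdiff_const|apply Cdiff_Cexp]. }
unfold circ in Hc.
replace (s - 2 * PI + 2 * PI)%R with s in Hc by ring. rewrite Rplus_0_l in Hc.
assert (Hh : hor H (2 * PI) (s - 2 * PI) s = hor H 0 (s - 2 * PI) s).
{ unfold hor. apply RInt_ext. intros t _. unfold H, Cexp. simpl fst; simpl snd.
  now rewrite cos_2PI, sin_2PI, cos_0, sin_0. }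
lra.
Qed.

(** The circular means agree at the radii r exp (- 2 PI n). At n = 0 the mean is at most M; for
    large n continuity brings it close to Re (f z0). *)
Lemma Re_max_principle (f : C -> C) (z0 : C) (r M : R) : (0 < r)%R ->
  (forall z, (Cmod (z - z0) <= r)%R -> exists D, Cdiff f z D) ->
  (forall z, Cmod (z - z0) = r -> (Re (f z) <= M)%R) -> (Re (f z0) <= M)%R.
Proof.
intros Hr Hf HM. assert (Hpi := PI_RGT_0).
(* This is 2 PI times the mean of Re f on the circle of radius exp s. *)
set (m := fun s => ver (fun w => f (z0 + Cexp w)) s 0 (2 * PI)).
assert (Hex : forall s, (s <= ln r)%R -> ex_RInt (fun t => Re (f (z0 + Cexp (s, t)))) 0 (2 * PI)).
{ intros s Hs. apply (ex_RInt_ver (fun w => f (z0 + Cexp w))); [lra|]. intros t _.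
  destruct (Hf (z0 + Cexp (s, t))) as [D HD].
  - replace (z0 + Cexp (s, t) - z0) with (Cexp (s, t)) by ring. rewrite Cmod_Cexp; simpl.
    rewrite <- (exp_ln r Hr). destruct Hs as [Hs| ->]; [now apply Rlt_le, exp_increasing|lra].
  - eapply Cdiff_cont. apply (Cdiff_comp f (fun w => z0 + Cexp w)); [exact HD|].
    apply Cdiff_plus; [apply Cdiff_const|apply Cdiff_Cexp]. }
assert (Hm : forall n : nat, m (ln r - INR n * (2 * PI))%R = m (ln r)).
{ induction n as [|n IH].
  - simpl. f_equal. ring.
  - rewrite <- IH, S_INR. unfold m.
    replace (ln r - (INR n + 1) * (2 * PI))%R with (ln r - INR n * (2 * PI) - 2 * PI)%R by ring.
    apply circular_mean_step. intros z Hz. apply Hf.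
    apply Rle_trans with (1 := Hz). rewrite <- (exp_ln r Hr) at 2.
    assert (0 <= INR n * (2 * PI))%R by (apply Rmult_le_pos; [apply pos_INR|lra]).
    destruct (Req_dec (ln r - INR n * (2 * PI)) (ln r)) as [->|Hne]; [lra|].
    apply Rlt_le, exp_increasing. lra. }
assert (Hle : (m (ln r) <= 2 * PI * M)%R).
{ unfold m, ver. replace (2 * PI * M)%R with ((2 * PI - 0) * M)%R by ring.
  rewrite <- RInt_Rconst.
  apply RInt_le; [lra|apply Hex; lra|apply ex_RInt_const|].
  intros t _. apply HM.
  replace (z0 + Cexp (ln r, t) - z0) with (Cexp (ln r, t)) by ring. rewrite Cmod_Cexp.
  now apply exp_ln. }
apply Rnot_lt_le. intros Hlt.
destruct (Hf z0) as [D HD].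
{ replace (z0 - z0) with (RtoC 0) by ring. rewrite Cmod_0. lra. }
destruct (Cdiff_cont _ _ _ HD ((Re (f z0) - M) / 2)%R) as [d [Hd Hcont]]; [lra|].
(* The integer part needs a nonnegative argument, hence [Rmax 0]; its strict upper bound is n + 1,
   hence [S n] below. *)
destruct (nfloor_ex (Rmax 0 (ln r - ln d) / (2 * PI))) as [n [_ Hn]].
{ apply Rmult_le_pos; [apply Rmax_l|]. apply Rlt_le, Rinv_0_lt_compat; lra. }
set (s := (ln r - INR (S n) * (2 * PI))%R).
assert (Hs : (exp s < d)%R).
{ rewrite <- (exp_ln d Hd). apply exp_increasing. unfold s. rewrite S_INR.
  apply Rmult_lt_compat_r with (r := (2 * PI)%R) in Hn; [|lra].
  replace (Rmax 0 (ln r - ln d) / (2 * PI) * (2 * PI))%R with (Rmax 0 (ln r - ln d)) in Hn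
    by (field; lra).
  assert (H := Rmax_r 0 (ln r - ln d)). lra. }
assert (Hsr : (s <= ln r)%R).
{ unfold s. assert (0 <= INR (S n) * (2 * PI))%R by (apply Rmult_le_pos; [apply pos_INR|lra]). lra. }
assert (Hgt : (2 * PI * M < m s)%R).
{ apply Rlt_le_trans with ((2 * PI - 0) * ((Re (f z0) + M) / 2))%R; [nra|].
  unfold m, ver. rewrite <- RInt_Rconst.
  apply RInt_le; [lra|apply ex_RInt_const|now apply Hex|].
  intros t _. specialize (Hcont (z0 + Cexp (s, t))).
  replace (z0 + Cexp (s, t) - z0) with (Cexp (s, t)) in Hcont by ring. rewrite Cmod_Cexp in Hcont.
  specialize (Hcont Hs). rewrite Cmod_sub_sym in Hcont.
  assert (H := Re_le_Cmod (f z0 - f (z0 + Cexp (s, t)))).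
  replace (Re (f z0 - f (z0 + Cexp (s, t)))) with (Re (f z0) - Re (f (z0 + Cexp (s, t))%C))%R in H
    by reflexivity.
  lra. }
specialize (Hm (S n)). fold s in Hm. lra.
Qed.

(** Multiplication by conj (f z0) turns the value at z0 into the real number |f z0|^2, so the bound
    on real parts applies. *)
Lemma max_modulus_principle (f : C -> C) (z0 : C) (r M : R) : (0 < r)%R ->
  (forall z, (Cmod (z - z0) <= r)%R -> exists D, Cdiff f z D) ->
  (forall z, Cmod (z - z0) = r -> (Cmod (f z) <= M)%R) -> (Cmod (f z0) <= M)%R.
Proof.
intros Hr Hf HM.
assert (H := Re_max_principle (fun z => Cconj (f z0) * f z) z0 r (Cmod (f z0) * M) Hr).
cbv beta in H. rewrite Re_conj_mult in H.
destruct (Rle_lt_or_eq_dec 0 _ (Cmod_ge_0 (f z0))) as [H0|H0].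
- apply Rmult_le_reg_l with (Cmod (f z0)); [exact H0|]. apply H.
  + intros z Hz. destruct (Hf z Hz) as [D HD]. eexists.
    apply Cdiff_mult; [apply Cdiff_const|exact HD].
  + intros z Hz. apply Rle_trans with (1 := Re_le_Cmod _).
    rewrite Cmod_mult, Cmod_conj. apply Rmult_le_compat_l; [lra|now apply HM].
- rewrite <- H0. apply Rle_trans with (Cmod (f (z0 + r))); [apply Cmod_ge_0|].
  apply HM. replace (z0 + r - z0) with (RtoC r) by ring. rewrite Cmod_R. apply Rabs_pos_eq; lra.
Qed.

(* Apply the maximum principle to [(z - z1) f^n], which is differentiable at [z1] too,
   and let [n] go to infinity. *)
Lemma max_modulus_principle_punctured (f : C -> C) (z0 z1 : C) (r M : R) : (0 < r)%R -> z1 <> z0 ->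
  (forall z, (Cmod (z - z0) <= r)%R -> z <> z1 -> exists D, Cdiff f z D) -> Ccont f z1 ->
  (forall z, Cmod (z - z0) = r -> (Cmod (f z) <= M)%R) -> (Cmod (f z0) <= M)%R.
Proof.
intros Hr Hz01 Hf Hc HM.
assert (HM0 : (0 <= M)%R).
{ apply Rle_trans with (Cmod (f (z0 + r))); [apply Cmod_ge_0|].
  apply HM. replace (z0 + r - z0) with (RtoC r) by ring. rewrite Cmod_R. apply Rabs_pos_eq; lra. }
assert (Hcn : forall n, Ccont (fun z => f z ^ n) z1).
{ intros n. now apply Ccont_pow. }
assert (Hn : forall n, (Cmod (z0 - z1) * Cmod (f z0) ^ n <= (r + Cmod (z0 - z1)) * M ^ n)%R).
{ intros n. rewrite <- Cmod_pow, <- Cmod_mult.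
  apply (max_modulus_principle (fun z => (z - z1) * f z ^ n) z0 r); [exact Hr| |].
  - intros z Hz. destruct (Ceq_dec z z1) as [->|Hne].
    (* The factor z - z1 turns continuity of f^n at z1 into differentiability of the product. *)
    + exists (f z1 ^ n). apply Cdiff_iff. intros eps Heps.
      destruct (Hcn n eps Heps) as [d [Hd H]]. exists d; split; [exact Hd|].
      intros w Hw. specialize (H w Hw).
      replace ((w - z1) * f w ^ n - (z1 - z1) * f z1 ^ n - (w - z1) * f z1 ^ n)
        with ((w - z1) * (f w ^ n - f z1 ^ n)) by ring.
      rewrite Cmod_mult, Rmult_comm. apply Rmult_le_compat_r; [apply Cmod_ge_0|lra].
    + destruct (Hf z Hz Hne) as [D HD]. destruct (Cdiff_pow f z D n HD) as [m Hm].
      eexists. apply Cdiff_mult; [|exact Hm].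
      apply Cdiff_minus; [apply Cdiff_id|apply Cdiff_const].
  - intros z Hz. rewrite Cmod_mult, Cmod_pow.
    apply Rmult_le_compat; try apply Cmod_ge_0.
    + apply pow_le, Cmod_ge_0.
    + rewrite <- Hz. replace (z - z1) with ((z - z0) + (z0 - z1)) by ring. apply Cmod_triangle.
    + apply pow_incr. split; [apply Cmod_ge_0|now apply HM]. }
(* Otherwise (M / |f z0|)^n tends to 0, while [Hn] keeps it above |z0 - z1| / (r + |z0 - z1|). *)
apply Rnot_lt_le. intros Hlt.
assert (Hd : (0 < Cmod (z0 - z1))%R).
{ apply Cmod_gt_0. intros E. apply Hz01. replace z1 with (z0 - (z0 - z1)) by ring. rewrite E. ring. }
assert (Hf0 : (0 < Cmod (f z0))%R) by lra.
set (q := (M / Cmod (f z0))%R).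
assert (Hq : (0 <= q < 1)%R).
{ split; [apply Rdiv_le_0_compat; lra|]. apply Rmult_lt_reg_r with (Cmod (f z0)); [lra|].
  unfold q. replace (M / Cmod (f z0) * Cmod (f z0))%R with M by (field; lra). lra. }
destruct (pow_lt_1_zero q) with (y := (Cmod (z0 - z1) / (r + Cmod (z0 - z1)))%R) as [n H].
{ rewrite Rabs_pos_eq; lra. }
{ apply Rdiv_lt_0_compat; lra. }
specialize (H n (Nat.le_refl n)). rewrite Rabs_pos_eq in H by (apply pow_le; lra).
specialize (Hn n).
assert (Hpn : (0 < Cmod (f z0) ^ n)%R) by now apply pow_lt.
assert (Eq : (M ^ n = q ^ n * Cmod (f z0) ^ n)%R).
{ rewrite <- Rpow_mult_distr. f_equal. unfold q. field. lra. }
rewrite Eq in Hn.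
apply Rmult_lt_compat_l with (r := (r + Cmod (z0 - z1))%R) in H; [|lra].
replace ((r + Cmod (z0 - z1)) * (Cmod (z0 - z1) / (r + Cmod (z0 - z1))))%R
  with (Cmod (z0 - z1)) in H by (field; lra).
nra.
Qed.

(** * Univalent functions *)

Lemma Cmod_sub_0 (z : C) : Cmod (z - z) = 0%R.
Proof. replace (z - z) with (RtoC 0) by ring. apply Cmod_0. Qed.

Lemma Cmod_sub_gt0 (z w : C) : z <> w -> (0 < Cmod (z - w))%R.
Proof.
intros H. apply Cmod_gt_0. intros E. apply H.
replace z with (z - w + w) by ring. rewrite E. ring.
Qed.

Lemma Ccont_comp (f g : C -> C) (z : C) : Ccont g z -> Ccont f (g z) -> Ccont (fun w => f (g w)) z.
Proof.
intros Hg Hf eps Heps. destruct (Hf eps Heps) as [d [Hd H]].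
destruct (Hg d Hd) as [d' [Hd' H']]. exists d'; split; [exact Hd'|].
intros w Hw. apply H, H', Hw.
Qed.

Lemma Ccont_inv (f : C -> C) (z : C) : Ccont f z -> f z <> 0 -> Ccont (fun w => / f w) z.
Proof.
intros Hf Hz. apply (Ccont_comp Cinv); [exact Hf|]. eapply Cdiff_cont. now apply Cdiff_Cinv.
Qed.

Lemma Ccont_ext_loc (f g : C -> C) (z : C) (d : R) : (0 < d)%R ->
  (forall w, (Cmod (w - z) < d)%R -> f w = g w) -> Ccont f z -> Ccont g z.
Proof.
intros Hd He H eps Heps. destruct (H eps Heps) as [d' [Hd' H']].
exists (Rmin d d'); split; [now apply Rmin_pos|]. intros w Hw.
rewrite <- He, <- (He z).
- apply H'. apply Rlt_le_trans with (1 := Hw), Rmin_r.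
- now rewrite Cmod_sub_0.
- apply Rlt_le_trans with (1 := Hw), Rmin_l.
Qed.

(** The difference quotient, filled in at z0 by D: it is continuous there exactly when D is the
    derivative. This one function serves for f / z, for its derivative, and for differentiating
    inverse functions. *)
Definition slope (f : C -> C) (z0 D z : C) : C :=
  if Ceq_dec z z0 then D else (f z - f z0) / (z - z0).

Lemma slope_at (f : C -> C) (z0 D : C) : slope f z0 D z0 = D.
Proof. unfold slope. destruct Ceq_dec; [reflexivity|contradiction]. Qed.

Lemma slope_ne (f : C -> C) (z0 D z : C) : z <> z0 -> slope f z0 D z = (f z - f z0) / (z - z0).
Proof. unfold slope. destruct Ceq_dec; [contradiction|reflexivity]. Qed.

Lemma slope_mult (f : C -> C) (z0 D z : C) : (z - z0) * slope f z0 D z = f z - f z0.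
Proof.
unfold slope. destruct Ceq_dec as [->|Hne]; [ring|]. field.
intros E. apply Hne. replace z with (z - z0 + z0) by ring. rewrite E. ring.
Qed.

Lemma Ccont_slope (f : C -> C) (z0 D : C) : Ccont (slope f z0 D) z0 <-> Cdiff f z0 D.
Proof.
rewrite Cdiff_iff. split.
- intros H eps Heps. destruct (H eps Heps) as [d [Hd H']]. exists d; split; [exact Hd|].
  intros w Hw. specialize (H' w Hw). rewrite slope_at in H'.
  rewrite <- (slope_mult f z0 D w).
  replace ((w - z0) * slope f z0 D w - (w - z0) * D) with ((w - z0) * (slope f z0 D w - D)) by ring.
  rewrite Cmod_mult, Rmult_comm. apply Rmult_le_compat_r; [apply Cmod_ge_0|lra].
- intros H eps Heps. destruct (H (eps / 2)%R) as [d [Hd H']]; [lra|]. exists d; split; [exact Hd|].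
  intros w Hw. specialize (H' w Hw). rewrite slope_at.
  destruct (Ceq_dec w z0) as [->|Hne]; [rewrite slope_at, Cmod_sub_0; exact Heps|].
  assert (Hp := Cmod_sub_gt0 _ _ Hne).
  rewrite <- (slope_mult f z0 D w) in H'.
  replace ((w - z0) * slope f z0 D w - (w - z0) * D) with ((w - z0) * (slope f z0 D w - D)) in H' by ring.
  rewrite Cmod_mult in H'.
  apply Rle_lt_trans with (eps / 2)%R; [|lra].
  apply Rmult_le_reg_l with (1 := Hp). lra.
Qed.

Lemma Cdiff_slope (f : C -> C) (z0 D z E : C) : z <> z0 -> Cdiff f z E ->
  Cdiff (slope f z0 D) z ((E - slope f z0 D z) / (z - z0)).
Proof.
intros Hne HE.
assert (Hp := Cmod_sub_gt0 _ _ Hne).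
assert (Hz : z - z0 <> 0) by now apply Cmod_gt_0.
apply (Cdiff_ext_loc (fun w => (f w - f z0) / (w - z0)) _ _ _ _ Hp).
- intros w Hw. rewrite slope_ne; [reflexivity|]. intros ->.
  rewrite Cmod_sub_sym in Hw. lra.
- eapply Cdiff_eq.
  + apply Cdiff_div; [| |exact Hz].
    * apply Cdiff_minus; [exact HE|apply Cdiff_const].
    * apply Cdiff_minus; [apply Cdiff_id|apply Cdiff_const].
  + cbv beta. rewrite slope_ne by exact Hne. field. exact Hz.
Qed.

(** * Open mapping and inverse of a univalent function *)

Lemma disk_ball (z0 : C) : disk z0 -> exists r, (0 < r)%R /\
  forall z, (Cmod (z - z0) <= r)%R -> disk z.
Proof.
intros H. unfold disk in *. exists ((1 - Cmod z0) / 2)%R; split; [lra|].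
intros z Hz. assert (H' := Cmod_tri_sub z z0). lra.
Qed.

Lemma Cmod_cont (f : C -> C) (w z : C) (eps : R) : Ccont f z -> (0 < eps)%R ->
  exists d, (0 < d)%R /\ forall v, (Cmod (v - z) < d)%R ->
    (Rabs (Cmod (f v - w) - Cmod (f z - w)) < eps)%R.
Proof.
intros Hf Heps. destruct (Hf eps Heps) as [d [Hd H]]. exists d; split; [exact Hd|].
intros v Hv. specialize (H v Hv).
assert (H1 := Cmod_tri_sub (f v - w) (f z - w)). assert (H2 := Cmod_tri_sub (f z - w) (f v - w)).
rewrite (Cmod_sub_sym (f z - w)) in H2.
replace (f v - w - (f z - w)) with (f v - f z) in H1, H2 by ring.
apply Rabs_def1; lra.
Qed.

Lemma closed_disk_closed (z0 : C) (r : R) (z : C) :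
  (forall d, (0 < d)%R -> exists w, (Cmod (w - z0) <= r)%R /\ (Cmod (w - z) < d)%R) ->
  (Cmod (z - z0) <= r)%R.
Proof.
intros H. apply Rnot_lt_le. intros Hlt.
destruct (H (Cmod (z - z0) - r)%R) as [w [H1 H2]]; [lra|].
assert (H3 := Cmod_tri_sub (z - z0) (w - z0)).
replace (z - z0 - (w - z0)) with (z - w) in H3 by ring. rewrite (Cmod_sub_sym z w) in H3. lra.
Qed.

Lemma circle_min (f : C -> C) (z0 : C) (r : R) : (0 < r)%R ->
  (forall z, Cmod (z - z0) = r -> Ccont f z) ->
  (forall z, Cmod (z - z0) = r -> f z <> f z0) ->
  exists d, (0 < d)%R /\ forall z, Cmod (z - z0) = r -> (d <= Cmod (f z - f z0))%R.
Proof.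
intros Hr Hc Hne.
destruct (compact_max (fun z => Cmod (z - z0) = r) (fun z => - Cmod (f z - f z0))%R
  (r + Cmod z0)) as [m [Hm Hmax]].
- exists (z0 + r). replace (z0 + r - z0) with (RtoC r) by ring. rewrite Cmod_R. apply Rabs_pos_eq; lra.
- intros z <-. assert (H := Cmod_tri_sub z z0). lra.
- intros z Hz. apply Rle_antisym.
  + apply closed_disk_closed. intros d Hd. destruct (Hz d Hd) as [w [E H]]. exists w; split; [now right|exact H].
  + apply Rnot_lt_le. intros Hlt. destruct (Hz (r - Cmod (z - z0))%R) as [w [H1 H2]]; [cbv beta in Hlt; lra|].
    cbv beta in H1, H2, Hlt. assert (H3 := Cmod_tri_sub (w - z0) (z - z0)).
    replace (w - z0 - (z - z0)) with (w - z) in H3 by ring. lra.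
- intros z Hz eps Heps. destruct (Cmod_cont f (f z0) z eps (Hc z Hz) Heps) as [d [Hd H]].
  exists d; split; [exact Hd|]. intros w _ Hw. specialize (H w Hw).
  apply Rabs_def2 in H. lra.
- exists (Cmod (f m - f z0)); split; [now apply Cmod_sub_gt0, Hne|].
  intros z Hz. specialize (Hmax z Hz). simpl in Hmax. lra.
Qed.

(* If [f' z0 = 0], apply the maximum principle to [(z - z1) / (f z - f z1)] for points [z1]
   close to [z0] with [f' z1 <> 0]: this bounds [|z0 - z1|] by a multiple of [|f z0 - f z1|]. *)
Lemma univalent_derive_neq0 (f : C -> C) (z0 D : C) :
  analytic f -> univalent f -> disk z0 -> Cdiff f z0 D -> D <> 0.
Proof.
intros Ha Hu Hz0 HD ->.
destruct (disk_ball z0 Hz0) as [r [Hr Hdisk]].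
destruct (circle_min f z0 r Hr) as [delta [Hdelta Hmin]].
{ intros z Hz. eapply Cdiff_cont, analytic_Cdiff; [exact Ha|]. apply Hdisk; lra. }
{ intros z Hz E. apply Hu in E; [|apply Hdisk; lra|exact Hz0].
  rewrite E, Cmod_sub_0 in Hz. lra. }
(* On the circle |z - z0| = r, for z1 close to z0, |z - z1| <= 2 r and |f z - f z1| >= delta / 2, so
   the quotient is at most [M]. *)
set (M := (4 * r / delta)%R).
assert (HM : (0 < M)%R) by (apply Rdiv_lt_0_compat; lra).
destruct (Cdiff_cont f z0 _ HD (delta / 2)%R) as [d1 [Hd1 H1]]; [lra|].
assert (HM2 : (0 < / (2 * M))%R) by (apply Rinv_0_lt_compat; lra).
(* The vanishing derivative gives |f z1 - f z0| <= |z1 - z0| / (2 M), to contradict |z1 - z0| <= M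
   |f z1 - f z0|. *)
destruct (proj1 (Cdiff_iff _ _ _) HD _ HM2) as [d2 [Hd2 H2]].
set (d := Rmin r (Rmin d1 d2)).
assert (Hd : (0 < d)%R) by (unfold d; repeat apply Rmin_pos; assumption).
assert (Hdr : (d <= r)%R) by apply Rmin_l.
assert (Hdd1 : (d <= d1)%R) by (apply Rle_trans with (1 := Rmin_r _ _), Rmin_l).
assert (Hdd2 : (d <= d2)%R) by (apply Rle_trans with (1 := Rmin_r _ _), Rmin_r).
(* If f' vanished throughout the ball, the mean value inequality would give f equal values at two
   points. *)
assert (Hnc : exists z1, z1 <> z0 /\ (Cmod (z1 - z0) < d)%R /\ C_derive f z1 <> 0).
{ apply NNPP. intros Hn.
  assert (Hall : forall z, (Cmod (z - z0) < d)%R -> C_derive f z = 0).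
  { intros z Hz. destruct (Ceq_dec z z0) as [->|Hne]; [now apply is_C_derive_unique|].
    apply NNPP. intros Hz'. apply Hn. now exists z. }
  assert (Hb : Cmod (RtoC (d / 2)) = (d / 2)%R) by (rewrite Cmod_R; apply Rabs_pos_eq; lra).
  assert (Hseg : forall t : R, (0 <= t <= 1)%R -> (Cmod (z0 + t * RtoC (d / 2) - z0) < d)%R).
  { intros t Ht. replace (z0 + t * RtoC (d / 2) - z0) with (t * RtoC (d / 2)) by ring.
    rewrite Cmod_mult, Hb, Cmod_R, Rabs_pos_eq by lra. nra. }
  assert (Hcd : forall t : R, (0 <= t <= 1)%R ->
    Cdiff f (z0 + t * RtoC (d / 2)) (C_derive f (z0 + t * RtoC (d / 2)))).
  { intros t Ht. apply analytic_Cdiff; [exact Ha|]. apply Hdisk. specialize (Hseg t Ht). lra. }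
  assert (Hmv := C_mean_value f (C_derive f) 0 z0 (RtoC (d / 2)) 0).
  assert (E : f (z0 + RtoC (d / 2)) = f z0).
  { replace (f (z0 + RtoC (d / 2))) with (f (z0 + RtoC (d / 2)) - f z0 - RtoC (d / 2) * 0 + f z0) by ring.
    rewrite (Cmod_eq_0 (f (z0 + RtoC (d / 2)) - f z0 - RtoC (d / 2) * 0)); [ring|].
    apply Rle_antisym; [|apply Cmod_ge_0]. rewrite Rmult_0_l in Hmv. apply Hmv.
    - eapply Cdiff_cont, HD.
    - assert (H := Hcd 1%R ltac:(lra)). rewrite Cmult_1_l in H. eapply Cdiff_cont, H.
    - intros t Ht. apply Hcd; lra.
    - intros t Ht. rewrite (Hall _ (Hseg t Ht)), Cmod_sub_0. lra. }
  apply Hu in E; [| |exact Hz0].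
  - assert (E' : RtoC (d / 2) = 0) by (replace (RtoC (d / 2)) with (z0 + RtoC (d / 2) - z0) by ring;
      rewrite E; ring).
    rewrite E', Cmod_0 in Hb. lra.
  - apply Hdisk. replace (z0 + RtoC (d / 2) - z0) with (RtoC (d / 2)) by ring. lra. }
destruct Hnc as [z1 [Hz1 [Hz1d HD1]]].
assert (Hz1disk : disk z1) by (apply Hdisk; lra).
assert (Hs : forall z, disk z -> slope f z1 (C_derive f z1) z <> 0).
{ intros z Hz E. destruct (Ceq_dec z z1) as [->|Hne].
  - rewrite slope_at in E. now apply HD1.
  - apply Hne, Hu; [exact Hz|exact Hz1disk|].
    replace (f z) with (f z - f z1 + f z1) by ring. rewrite <- (slope_mult f z1 (C_derive f z1)), E. ring. }
assert (Hbound : (Cmod (/ slope f z1 (C_derive f z1) z0) <= M)%R).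
{ apply (max_modulus_principle_punctured (fun z => / slope f z1 (C_derive f z1) z) z0 z1 r M);
    [exact Hr|exact Hz1| | |].
  - intros z Hz Hne. eexists. apply Cdiff_inv; [|apply Hs, Hdisk, Hz].
    apply Cdiff_slope; [exact Hne|]. apply analytic_Cdiff; [exact Ha|apply Hdisk, Hz].
  - apply Ccont_inv; [|now apply Hs]. apply Ccont_slope, analytic_Cdiff; assumption.
  - intros z Hz.
    assert (Hzd : disk z) by (apply Hdisk; lra).
    specialize (Hs z Hzd). rewrite Cmod_inv by exact Hs.
    assert (Hsp := proj1 (Cmod_gt_0 _) Hs).
    assert (E := f_equal Cmod (slope_mult f z1 (C_derive f z1) z)). rewrite Cmod_mult in E.
    assert (T1 := Cmod_triangle (z - z0) (z0 - z1)).
    replace (z - z0 + (z0 - z1)) with (z - z1) in T1 by ring.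
    rewrite (Cmod_sub_sym z0) in T1.
    assert (T2 := Cmod_tri_sub (f z - f z0) (f z1 - f z0)).
    replace (f z - f z0 - (f z1 - f z0)) with (f z - f z1) in T2 by ring.
    assert (T3 := H1 z1 ltac:(lra)). assert (T4 := Hmin z Hz).
    set (S := Cmod (slope f z1 (C_derive f z1) z)) in *.
    apply Rmult_le_reg_r with S; [exact Hsp|]. rewrite Rinv_l by lra.
    assert (T5 : (delta / 2 <= 2 * r * S)%R) by nra.
    unfold M. apply Rmult_le_reg_r with delta; [exact Hdelta|].
    replace (4 * r / delta * S * delta)%R with (4 * r * S)%R by (field; lra). lra. }
assert (E := f_equal Cmod (slope_mult f z1 (C_derive f z1) z0)). rewrite Cmod_mult in E.
specialize (Hs z0 Hz0). rewrite Cmod_inv in Hbound by exact Hs.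
assert (Hsp := proj1 (Cmod_gt_0 _) Hs).
specialize (H2 z1 ltac:(lra)).
replace (f z1 - f z0 - (z1 - z0) * 0) with (f z1 - f z0) in H2 by ring.
rewrite (Cmod_sub_sym (f z0)), (Cmod_sub_sym z0), Rmult_comm in E.
assert (Hp := Cmod_sub_gt0 _ _ Hz1).
set (S := Cmod (slope f z1 (C_derive f z1) z0)) in *.
assert (HSM : (1 <= M * S)%R).
{ apply Rmult_le_compat_r with (r := S) in Hbound; [|lra]. rewrite Rinv_l in Hbound by lra. exact Hbound. }
rewrite <- E in H2. apply Rmult_le_reg_r in H2; [|exact Hp].
apply Rmult_le_compat_l with (r := M) in H2; [|lra].
replace (M * / (2 * M))%R with (/ 2)%R in H2 by (field; lra). lra.
Qed.

(** For w close to f z0, |f - w| is larger on the circle than at z0, so its minimum over the closed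
    disk is attained inside. A nonzero minimum could be lowered by a small Newton step, as f' does
    not vanish. *)
Lemma univalent_open (f : C -> C) (z0 : C) (rho : R) :
  analytic f -> univalent f -> disk z0 -> (0 < rho)%R ->
  exists eps, (0 < eps)%R /\ forall w, (Cmod (w - f z0) < eps)%R ->
    exists z, disk z /\ (Cmod (z - z0) < rho)%R /\ f z = w.
Proof.
intros Ha Hu Hz0 Hrho.
destruct (disk_ball z0 Hz0) as [r0 [Hr0 Hdisk0]].
set (r := Rmin r0 (rho / 2)).
assert (Hr : (0 < r)%R) by (apply Rmin_pos; lra).
assert (Hrr : (r <= rho / 2)%R) by apply Rmin_r.
assert (Hdisk : forall z, (Cmod (z - z0) <= r)%R -> disk z).
{ intros z Hz. apply Hdisk0. apply Rle_trans with (1 := Hz), Rmin_l. }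
assert (Hcont : forall z, (Cmod (z - z0) <= r)%R -> Ccont f z).
{ intros z Hz. eapply Cdiff_cont, analytic_Cdiff; [exact Ha|now apply Hdisk]. }
destruct (circle_min f z0 r Hr) as [delta [Hdelta Hmin]].
{ intros z Hz. apply Hcont; lra. }
{ intros z Hz E. apply Hu in E; [|apply Hdisk; lra|exact Hz0].
  rewrite E, Cmod_sub_0 in Hz. lra. }
exists (delta / 2)%R; split; [lra|]. intros w Hw.
destruct (compact_max (fun z => (Cmod (z - z0) <= r)%R) (fun z => - Cmod (f z - w))%R
  (r + Cmod z0)) as [m [Hm Hmax]].
- exists z0. rewrite Cmod_sub_0. lra.
- intros z Hz. assert (H := Cmod_tri_sub z z0). lra.
- apply closed_disk_closed.
- intros z Hz eps Heps. destruct (Cmod_cont f w z eps (Hcont z Hz) Heps) as [d [Hd H]].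
  exists d; split; [exact Hd|]. intros v _ Hv. specialize (H v Hv).
  apply Rabs_def2 in H. lra.
- exists m. split; [now apply Hdisk|]. split; [lra|].
  assert (Hm0 := Hmax z0). rewrite Cmod_sub_0 in Hm0. specialize (Hm0 ltac:(lra)).
  rewrite (Cmod_sub_sym (f z0)) in Hm0.
  assert (Hin : (Cmod (m - z0) < r)%R).
  { apply Rnot_le_lt. intros Hge. assert (Hmr : Cmod (m - z0) = r) by lra.
    specialize (Hmin m Hmr). assert (T := Cmod_triangle (f m - w) (w - f z0)).
    replace (f m - w + (w - f z0)) with (f m - f z0) in T by ring. lra. }
  apply NNPP. intros Hne. assert (HA := Cmod_sub_gt0 _ _ Hne).
  assert (HD := analytic_Cdiff f m Ha (Hdisk m Hm)).
  assert (HD0 := univalent_derive_neq0 f m _ Ha Hu (Hdisk m Hm) HD).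
  set (A := Cmod (f m - w)) in *. set (D := C_derive f m) in *.
  (* The Newton direction: f (m + t b) - w is (1 - t) (f m - w) up to an error smaller than t |f m -
     w|. *)
  set (b := - ((f m - w) / D)).
  assert (Hb := Cmod_ge_0 b).
  assert (He : (0 < A / (2 * (1 + Cmod b)))%R) by (apply Rdiv_lt_0_compat; lra).
  destruct (proj1 (Cdiff_iff _ _ _) HD _ He) as [d [Hd H]].
  set (t := Rmin 1 (Rmin (d / (2 * (1 + Cmod b))) ((r - Cmod (m - z0)) / (1 + Cmod b)))).
  assert (Ht : (0 < t)%R).
  { repeat apply Rmin_pos; try apply Rdiv_lt_0_compat; lra. }
  assert (Ht1 : (t <= 1)%R) by apply Rmin_l.
  assert (Htd : (t * (1 + Cmod b) <= d / 2)%R).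
  { assert (Hx : (t <= d / (2 * (1 + Cmod b)))%R)
      by (apply Rle_trans with (1 := Rmin_r _ _), Rmin_l).
    apply Rmult_le_compat_r with (r := (1 + Cmod b)%R) in Hx; [|lra].
    replace (d / (2 * (1 + Cmod b)) * (1 + Cmod b))%R with (d / 2)%R in Hx by (field; lra). exact Hx. }
  assert (Htr : (t * (1 + Cmod b) <= r - Cmod (m - z0))%R).
  { assert (Hx : (t <= (r - Cmod (m - z0)) / (1 + Cmod b))%R)
      by (apply Rle_trans with (1 := Rmin_r _ _), Rmin_r).
    apply Rmult_le_compat_r with (r := (1 + Cmod b)%R) in Hx; [|lra].
    replace ((r - Cmod (m - z0)) / (1 + Cmod b) * (1 + Cmod b))%R
      with (r - Cmod (m - z0))%R in Hx by (field; lra). exact Hx. }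
  assert (Etb : Cmod (t * b) = (t * Cmod b)%R) by (rewrite Cmod_mult, Cmod_R, Rabs_pos_eq; lra).
  specialize (H (m + t * b)). specialize (Hmax (m + t * b)).
  replace (m + t * b - m) with (t * b) in H by ring.
  rewrite Etb in H. specialize (H ltac:(lra)).
  assert (Hk : (Cmod (m + t * b - z0) <= r)%R).
  { replace (m + t * b - z0) with (m - z0 + t * b) by ring.
    apply Rle_trans with (1 := Cmod_triangle _ _). rewrite Etb. lra. }
  specialize (Hmax Hk). simpl in Hmax.
  replace (f (m + t * b) - w) with
    ((f (m + t * b) - f m - t * b * D) + (1 - t)%R * (f m - w)) in Hmax.
  2:{ rewrite RtoC_minus. unfold b. field. exact HD0. }
  assert (T := Cmod_triangle (f (m + t * b) - f m - t * b * D) ((1 - t)%R * (f m - w))).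
  rewrite (Cmod_mult (RtoC (1 - t))), Cmod_R, Rabs_pos_eq in T by lra. fold A in T.
  assert (Q : (A / (2 * (1 + Cmod b)) * (t * Cmod b) < t * A)%R).
  { apply Rle_lt_trans with (A / (2 * (1 + Cmod b)) * (t * (1 + Cmod b)))%R.
    - apply Rmult_le_compat_l; [lra|]. apply Rmult_le_compat_l; lra.
    - replace (A / (2 * (1 + Cmod b)) * (t * (1 + Cmod b)))%R with (t * A / 2)%R by (field; lra).
      assert (0 < t * A)%R by now apply Rmult_lt_0_compat. lra. }
  lra.
Qed.

(** [omega] picks preimages under Psi. Openness and injectivity make it continuous; then its
    difference quotient is that of p divided by that of Psi along [omega], whose limit Psi' is not
    zero. *)
Lemma subordinate_univalent (Psi p : C -> C) : analytic Psi -> univalent Psi ->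
  analytic p -> p 0 = Psi 0 -> (forall z, disk z -> image_disk Psi (p z)) -> subordinate p Psi.
Proof.
intros Ha Hu Hp Hp0 Him. split; [exact Hp|split; [exact Ha|]].
assert (Hex : forall z, exists w, disk z -> disk w /\ Psi w = p z).
{ intros z. destruct (classic (disk z)) as [Hz|Hz]; [|now exists 0].
  destruct (Him z Hz) as [w H]. now exists w. }
set (omega := fun z => proj1_sig (constructive_indefinite_description _ (Hex z))).
assert (Hom : forall z, disk z -> disk (omega z) /\ Psi (omega z) = p z).
{ intros z Hz. unfold omega. destruct constructive_indefinite_description as [w Hw]; simpl. auto. }
assert (H0 : disk 0) by (unfold disk; rewrite Cmod_0; lra).
exists omega. split; [|split; [|split]].
- intros z Hz. destruct (Hom z Hz) as [Ho Eo].
  destruct (disk_ball z Hz) as [r [Hr Hdisk]].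
  assert (HP := analytic_Cdiff p z Hp Hz). set (P := C_derive p z) in *.
  assert (HD := analytic_Cdiff Psi _ Ha Ho). set (D := C_derive Psi (omega z)) in *.
  assert (HD0 := univalent_derive_neq0 _ _ _ Ha Hu Ho HD).
  assert (Hoc : Ccont omega z).
  { intros eps Heps. destruct (univalent_open Psi (omega z) eps Ha Hu Ho Heps) as [e [He H]].
    destruct (Cdiff_cont _ _ _ HP e He) as [d [Hd H']].
    exists (Rmin r d); split; [now apply Rmin_pos|]. intros w Hw.
    assert (Hwd : disk w).
    { apply Hdisk, Rlt_le, Rlt_le_trans with (1 := Hw), Rmin_l. }
    specialize (H' w (Rlt_le_trans _ _ _ Hw (Rmin_r _ _))). rewrite <- Eo in H'.
    destruct (H _ H') as [v [Hv [Hvo Ev]]]. destruct (Hom w Hwd) as [Hw1 Hw2].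
    replace (omega w) with v; [exact Hvo|]. apply Hu; try assumption. now rewrite Hw2. }
  exists (P / D). change (Cdiff omega z (P / D)). apply Ccont_slope.
  apply (Ccont_ext_loc (fun w => slope p z P w * / slope Psi (omega z) D (omega w)) _ _ r Hr).
  2:{ apply Ccont_mult; [now apply Ccont_slope|].
      apply (Ccont_inv (fun w => slope Psi (omega z) D (omega w))); [|now rewrite slope_at].
      apply (Ccont_comp (slope Psi (omega z) D) omega); [exact Hoc|now apply Ccont_slope]. }
  intros w Hw. destruct (Hom w (Hdisk w ltac:(lra))) as [Hw1 Hw2].
  destruct (Ceq_dec w z) as [->|Hne]; [now rewrite !slope_at|].
  rewrite (slope_ne omega), (slope_ne p) by exact Hne.
  assert (Hwz : w - z <> 0) by now apply Cmod_gt_0, Cmod_sub_gt0.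
  (* If the two values of [omega] agree, so do those of p, and both sides are 0. *)
  destruct (Ceq_dec (omega w) (omega z)) as [E|Hno].
  + rewrite <- Hw2, <- Eo, E, slope_at. field. tauto.
  + rewrite (slope_ne Psi) by exact Hno. rewrite <- Hw2, <- Eo. field.
    repeat split; try exact Hwz; apply Cmod_gt_0, Cmod_sub_gt0; [exact Hno|].
    intros E. apply Hno, Hu; assumption.
- destruct (Hom 0 H0) as [Ho Eo]. apply Hu; try assumption. now rewrite Eo.
- intros z Hz. now apply Hom.
- intros z Hz. symmetry. now apply Hom.
Qed.

(** * Separation of a point from an open convex set *)

(** A meets the real axis in positive points only. Where a segment from the lower to the upper
    half-plane crosses the axis, this says that Re / Im is no larger at the lower end than at the
    upper one; m is the supremum over the lower part. Openness at 1 makes both parts nonempty. *)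
Lemma convex_separation_normalized (A : C -> Prop) : convex A ->
  (forall v, A v -> exists e, (0 < e)%R /\ forall u, (Cmod (u - v) < e)%R -> A u) ->
  A 1 -> ~ A 0 -> exists m : R, forall u, A u -> (0 <= Re u - m * Im u)%R.
Proof.
intros Hcv Hop H1 H0.
assert (Hreal : forall x : R, A (RtoC x) -> (0 < x)%R).
{ intros x Hx. apply Rnot_le_lt. intros Hle. apply H0.
  assert (Hd : (0 < 1 - x)%R) by lra.
  replace (RtoC 0) with (RtoC (1 - - x / (1 - x)) * RtoC x + RtoC (- x / (1 - x)) * 1).
  - apply Hcv; [exact Hx|exact H1|]. split; [apply Rdiv_le_0_compat; lra|].
    apply Rmult_le_reg_r with (1 - x)%R; [lra|].
    replace (- x / (1 - x) * (1 - x))%R with (- x)%R by (field; lra). lra.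
  - apply injective_projections; simpl; field; lra. }
assert (Hcross : forall u v, A u -> A v -> (0 < Im u)%R -> (Im v < 0)%R ->
  (Re v / Im v <= Re u / Im u)%R).
{ intros u v Hu Hv Pu Pv.
  (* The weight at which the segment from u to v crosses the real axis. *)
  set (t := (Im u / (Im u - Im v))%R).
  assert (Hx : (0 < (Im u * Re v - Im v * Re u) / (Im u - Im v))%R).
  { apply Hreal. replace (RtoC ((Im u * Re v - Im v * Re u) / (Im u - Im v)))
      with (RtoC (1 - t) * u + RtoC t * v).
    - apply Hcv; [exact Hu|exact Hv|]. unfold t. split; [apply Rdiv_le_0_compat; lra|].
      apply Rmult_le_reg_r with (Im u - Im v)%R; [lra|].
      replace (Im u / (Im u - Im v) * (Im u - Im v))%R with (Im u) by (field; lra). lra.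
    - unfold t. destruct u as [a b], v as [c d]. unfold Re, Im in *. simpl in *.
      apply injective_projections; simpl; field; lra. }
  apply Rmult_lt_compat_r with (r := (Im u - Im v)%R) in Hx; [|lra].
  replace ((Im u * Re v - Im v * Re u) / (Im u - Im v) * (Im u - Im v))%R
    with (Im u * Re v - Im v * Re u)%R in Hx by (field; lra).
  apply Rmult_le_reg_r with (Im u * - Im v)%R; [nra|].
  replace (Re v / Im v * (Im u * - Im v))%R with (- (Im u * Re v))%R by (field; lra).
  replace (Re u / Im u * (Im u * - Im v))%R with (- (Im v * Re u))%R by (field; lra). lra. }
destruct (Hop 1 H1) as [e [He Hball]].
assert (Hup : exists u, A u /\ (0 < Im u)%R).
{ exists (1, (e / 2)%R). split; [|unfold Im; simpl; lra]. apply Hball.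
  apply Rle_lt_trans with (1 := Cmod_le_Rabs _). simpl.
  replace (1 + - (1))%R with 0%R by ring. rewrite Rabs_R0, Rabs_pos_eq; lra. }
assert (Hdn : exists u, A u /\ (Im u < 0)%R).
{ exists (1, (- (e / 2))%R). split; [|unfold Im; simpl; lra]. apply Hball.
  apply Rle_lt_trans with (1 := Cmod_le_Rabs _). simpl.
  replace (1 + - (1))%R with 0%R by ring. rewrite Rabs_R0.
  replace (- (e / 2) + - 0)%R with (- (e / 2))%R by ring. rewrite Rabs_Ropp, Rabs_pos_eq; lra. }
destruct Hup as [up [Aup Iup]]. destruct Hdn as [dn [Adn Idn]].
destruct (completeness (fun x => exists v, A v /\ (Im v < 0)%R /\ x = (Re v / Im v)%R))
  as [m [Hub Hlub]].
- exists (Re up / Im up)%R. intros x [v [Av [Iv ->]]]. now apply Hcross.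
- now exists (Re dn / Im dn)%R, dn.
- exists m. intros u Au. destruct (Rtotal_order (Im u) 0) as [Hlt|[Heq|Hgt]].
  + assert (H : (Re u / Im u <= m)%R) by (apply Hub; now exists u).
    apply Rmult_le_compat_r with (r := (- Im u)%R) in H; [|lra].
    replace (Re u / Im u * - Im u)%R with (- Re u)%R in H by (field; lra). lra.
  + rewrite Heq. assert (0 < Re u)%R; [|lra]. apply Hreal.
    replace (RtoC (Re u)) with u; [exact Au|]. apply injective_projections; simpl; auto.
  + assert (H : (m <= Re u / Im u)%R).
    { apply Hlub. intros x [v [Av [Iv ->]]]. now apply Hcross. }
    apply Rmult_le_compat_r with (r := Im u) in H; [|lra].
    replace (Re u / Im u * Im u)%R with (Re u) in H by (field; lra). lra.
Qed.

(** The affine map v -> (v - w) / (a - w) sends w to 0 and a to 1. Strictness comes from openness: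
    at a point with equality, a small step along - conj k would make the real part negative. *)
Lemma convex_separation (A : C -> Prop) (a w : C) : convex A ->
  (forall v, A v -> exists e, (0 < e)%R /\ forall u, (Cmod (u - v) < e)%R -> A u) ->
  A a -> ~ A w -> exists k : C, forall v, A v -> (0 < Re (k * (v - w)))%R.
Proof.
intros Hcv Hop Ha Hw.
set (b := a - w).
assert (Hb : b <> 0).
{ intros E. apply Hw. replace w with (a - b) by (unfold b; ring). rewrite E.
  now replace (a - 0) with a by ring. }
assert (Hbp := proj1 (Cmod_gt_0 b) Hb).
destruct (convex_separation_normalized (fun u => A (w + u * b))) as [m Hm].
- intros u v t Hu Hv Ht.
  replace (w + (RtoC (1 - t) * u + RtoC t * v) * b) with
    (RtoC (1 - t) * (w + u * b) + RtoC t * (w + v * b)) by (rewrite RtoC_minus; ring).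
  now apply Hcv.
- intros v Hv. destruct (Hop _ Hv) as [e [He H]].
  exists (e / Cmod b)%R; split; [now apply Rdiv_lt_0_compat|].
  intros u Hu. apply H. replace (w + u * b - (w + v * b)) with ((u - v) * b) by ring.
  rewrite Cmod_mult. apply Rmult_lt_compat_r with (r := Cmod b) in Hu; [|exact Hbp].
  replace (e / Cmod b * Cmod b)%R with e in Hu by (field; lra). exact Hu.
- replace (w + 1 * b) with a by (unfold b; ring). exact Ha.
- replace (w + 0 * b) with w by ring. exact Hw.
(* Re ((1 + i m) u) = Re u - m Im u. *)
- set (k := (1, m) / b). exists k.
  assert (Hk : k <> 0).
  { intros E. assert (E' : k * b = (1%R, m)) by (unfold k; field; exact Hb). rewrite E in E'.
    apply (f_equal fst) in E'. simpl in E'. lra. }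
  assert (Hge : forall v, A v -> (0 <= Re (k * (v - w)))%R).
  { intros v Hv. specialize (Hm ((v - w) / b)). cbv beta in Hm.
    replace (w + (v - w) / b * b) with v in Hm by (field; exact Hb). specialize (Hm Hv).
    replace (k * (v - w)) with ((1, m) * ((v - w) / b)) by (unfold k; field; exact Hb).
    destruct ((v - w) / b) as [x y]. unfold Re, Im in *; simpl in *. lra. }
  intros v Hv. destruct (Rle_lt_or_eq_dec _ _ (Hge v Hv)) as [H|H]; [exact H|exfalso].
  destruct (Hop v Hv) as [e [He Hball]].
  assert (Hkp := proj1 (Cmod_gt_0 k) Hk).
  set (s := (e / (2 * Cmod k))%R).
  assert (Hs : (0 < s)%R) by (apply Rdiv_lt_0_compat; lra).
  specialize (Hge (v - RtoC s * Cconj k)).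
  assert (Hin : A (v - RtoC s * Cconj k)).
  { apply Hball. replace (v - RtoC s * Cconj k - v) with (- (RtoC s * Cconj k)) by ring.
    rewrite Cmod_opp, Cmod_mult, Cmod_conj, Cmod_R, Rabs_pos_eq by lra.
    unfold s. replace (e / (2 * Cmod k) * Cmod k)%R with (e / 2)%R by (field; lra). lra. }
  specialize (Hge Hin).
  assert (Ex : forall (k v w : C) (s : R), Re (k * (v - RtoC s * Cconj k - w)) =
    (Re (k * (v - w)%C)%C - s * Re (Cconj k * k)%C)%R)
    by (intros [k1 k2] [v1 v2] [w1 w2] s'; unfold Re; simpl; ring).
  rewrite Ex in Hge.
  rewrite <- H, Re_conj_mult in Hge.
  assert (0 < s * (Cmod k * Cmod k))%R by (apply Rmult_lt_0_compat; [exact Hs|nra]). lra.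
Qed.

(** * Moment integrals *)

Definition CInt (f : R -> C) (a b : R) (l : C) : Prop :=
  is_RInt (V := C_R_NormedModule) f a b l.

Lemma CInt_unique (f : R -> C) (a b : R) (l : C) : CInt f a b l ->
  RInt (V := C_R_CompleteNormedModule) f a b = l.
Proof. exact (is_RInt_unique (V := C_R_CompleteNormedModule) f a b l). Qed.

(** The integral is taken in C as a module over R, so a complex factor has to go through the
    components. *)
Lemma CInt_scal (f : R -> C) (a b : R) (k l : C) :
  CInt f a b l -> CInt (fun t => k * f t) a b (k * l).
Proof.
intros H.
assert (H1 := is_RInt_fct_extend_fst f a b l H). assert (H2 := is_RInt_fct_extend_snd f a b l H).
apply (is_RInt_fct_extend_pair (U := R_NormedModule) (V := R_NormedModule)).
- exact (is_RInt_minus _ _ _ _ _ _ (is_RInt_scal _ _ _ (fst k) _ H1) (is_RInt_scal _ _ _ (snd k) _ H2)).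
- exact (is_RInt_plus _ _ _ _ _ _ (is_RInt_scal _ _ _ (fst k) _ H2) (is_RInt_scal _ _ _ (snd k) _ H1)).
Qed.

Lemma CInt_plus (f g : R -> C) (a b : R) (l m : C) :
  CInt f a b l -> CInt g a b m -> CInt (fun t => f t + g t) a b (l + m).
Proof. exact (is_RInt_plus (V := C_R_NormedModule) f g a b l m). Qed.

Lemma Ccont_continuous (psi : C -> C) (t : R) : Ccont psi (RtoC t) ->
  continuous (T := R_UniformSpace) (U := C_UniformSpace) (fun t : R => psi (RtoC t)) t.
Proof.
intros H. apply filterlim_locally. intros eps.
destruct (H eps (cond_pos eps)) as [d [Hd H']]. exists (mkposreal d Hd).
intros s Hs. apply C_NormedModule_mixin_compat1. apply H'.
rewrite <- RtoC_minus, Cmod_R. exact Hs.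
Qed.

Lemma Cdiff_is_derive_R (psi : C -> C) (t : R) (D : C) : Cdiff psi (RtoC t) D ->
  is_derive (K := R_AbsRing) (V := C_R_NormedModule) (fun t : R => psi (RtoC t)) t D.
Proof.
rewrite Cdiff_iff. intros H. split; [apply is_linear_scal_l|].
intros x Hx [eps Heps].
rewrite <- (@is_filter_lim_locally_unique R_AbsRing R_NormedModule t x Hx).
destruct (H eps Heps) as [d [Hd H']]. exists (mkposreal d Hd).
intros s Hs. specialize (H' (RtoC s)). rewrite <- RtoC_minus, Cmod_R in H'. specialize (H' Hs).
rewrite <- Cmod_norm. simpl pos.
match goal with |- (Cmod ?x <= _)%R =>
  replace x with (psi s - psi t - RtoC (s - t) * D); [exact H'|] end.
apply injective_projections; unfold minus, plus, opp, scal; simpl;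
  unfold mult, plus, opp; simpl; unfold scal; simpl; unfold mult; simpl; ring.
Qed.

Lemma Ccont_CInt (psi : C -> C) : (forall t, (0 <= t <= 1)%R -> Ccont psi (RtoC t)) ->
  exists l, CInt (fun t => psi (RtoC t)) 0 1 l.
Proof.
intros H. apply (ex_RInt_continuous (V := C_R_CompleteNormedModule)).
rewrite Rmin_left, Rmax_right by lra. intros t Ht. now apply Ccont_continuous, H.
Qed.

Lemma CInt_derive (psi dpsi : C -> C) :
  (forall t, (0 <= t <= 1)%R -> Cdiff psi (RtoC t) (dpsi (RtoC t))) ->
  (forall t, (0 <= t <= 1)%R -> Ccont dpsi (RtoC t)) ->
  CInt (fun t => dpsi (RtoC t)) 0 1 (psi 1 - psi 0).
Proof.
intros H1 H2.
apply (is_RInt_derive (V := C_R_CompleteNormedModule) (fun t => psi (RtoC t)) (fun t => dpsi (RtoC t)));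
rewrite Rmin_left, Rmax_right by lra; intros t Ht.
- now apply Cdiff_is_derive_R, H1.
- now apply Ccont_continuous, H2.
Qed.

Lemma CInt_bound (f : R -> C) (l : C) (M : R) : CInt f 0 1 l ->
  (forall t, (0 <= t <= 1)%R -> (Cmod (f t) <= M)%R) -> (Cmod l <= M)%R.
Proof.
intros H HM. rewrite Cmod_norm.
replace M with ((1 - 0) * M)%R by ring.
apply (norm_RInt_le_const (V := C_R_NormedModule) f 0 1 l M); [lra| |exact H].
intros t Ht. rewrite <- Cmod_norm. now apply HM.
Qed.

(** Compactness of the parameter interval yields one radius for all points t z. The local radii are
    halved to leave room for |t z - x z| <= |t - x|, which uses |z| < 1. *)
Lemma segment_uniform_cont (f : C -> C) (z : C) (eps : R) : disk z ->
  (forall v, disk v -> Ccont f v) -> (0 < eps)%R ->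
  exists d, (0 < d)%R /\ forall (t : R) (v : C), (0 <= t <= 1)%R ->
    (Cmod (v - t * z) < d)%R -> disk v /\ (Cmod (f v - f (t * z)%C) < eps)%R.
Proof.
intros Hz Hf Heps. unfold disk in Hz.
assert (Htz : forall t : R, (0 <= t <= 1)%R -> (Cmod (t * z) <= Cmod z)%R).
{ intros t Ht. rewrite Cmod_mult, Cmod_R, Rabs_pos_eq by lra.
  assert (H := Cmod_ge_0 z). nra. }
assert (Hex : forall t : R, exists d : posreal, (0 <= t <= 1)%R -> forall v,
  (Cmod (v - t * z) < 2 * d)%R -> (Cmod (f v - f (t * z)%C) < eps / 2)%R).
{ intros t. destruct (classic (0 <= t <= 1)%R) as [Ht|Ht].
  2:{ exists (mkposreal 1 Rlt_0_1). tauto. }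
  destruct (Hf (t * z)) with (eps := (eps / 2)%R) as [d [Hd H]]; [|lra|].
  - unfold disk. specialize (Htz t Ht). lra.
  - assert (Hd2 : (0 < d / 2)%R) by lra. exists (mkposreal _ Hd2). intros _ v Hv.
    apply H. simpl in Hv. lra. }
destruct (compactness_value_1d 0 1
  (fun t => proj1_sig (constructive_indefinite_description _ (Hex t)))) as [d Hd].
exists (Rmin d (1 - Cmod z)); split; [apply Rmin_pos; [apply cond_pos|lra]|].
intros t v Ht Hv. split.
- unfold disk. assert (H1 := Cmod_tri_sub v (t * z)). specialize (Htz t Ht).
  assert (H2 := Rmin_r d (1 - Cmod z)). lra.
- apply NNPP. intros Hn. apply (Hd t Ht). intros [x [Hx [Htx Hdx]]]. apply Hn.
  destruct constructive_indefinite_description as [e He]. simpl in *. specialize (He Hx).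
  assert (Hvd := Rlt_le_trans _ _ _ Hv (Rmin_l _ _)).
  assert (Htxz : (Cmod (t * z - x * z) <= Rabs (t - x))%R).
  { replace (t * z - x * z) with ((t - x)%R * z) by (rewrite RtoC_minus; ring).
    rewrite Cmod_mult, Cmod_R. assert (H := Rabs_pos (t - x)). nra. }
  assert (He0 := cond_pos e).
  assert (P1 := He (t * z) ltac:(lra)).
  assert (P2 : (Cmod (f v - f (x * z)%C) < eps / 2)%R).
  { apply He. replace (v - x * z) with ((v - t * z) + (t * z - x * z)) by ring.
    apply Rle_lt_trans with (1 := Cmod_triangle _ _). lra. }
  replace (f v - f (t * z)%C) with ((f v - f (x * z)%C) + - (f (t * z)%C - f (x * z)%C)) by ring.
  apply Rle_lt_trans with (1 := Cmod_triangle _ _). rewrite Cmod_opp. lra.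
Qed.

(** For n = c and f replaced by h this is G / (1 + c). Differentiation in z brings out a factor t
    and so raises n by one. *)
Definition moment (n : nat) (f : C -> C) (z : C) : C :=
  RInt (V := C_R_CompleteNormedModule) (fun t : R => RtoC t ^ n * f (RtoC t * z)) 0 1.

Lemma disk_segment (z : C) (t : R) : disk z -> (0 <= t <= 1)%R -> disk (t * z).
Proof.
intros Hz Ht. unfold disk in *. rewrite Cmod_mult, Cmod_R, Rabs_pos_eq by lra.
assert (H := Cmod_ge_0 z). nra.
Qed.

Lemma Ccont_id (z : C) : Ccont (fun w => w) z.
Proof. intros eps Heps. now exists eps. Qed.

Lemma Ccont_moment (n : nat) (f : C -> C) (z : C) (t : R) : Ccont f (t * z)%C ->
  Ccont (fun w => w ^ n * f (w * z)) t.
Proof.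
intros H. apply Ccont_mult; [apply Ccont_pow, Ccont_id|].
apply (Ccont_comp f (fun w => w * z)); [|exact H].
apply Ccont_mult; [apply Ccont_id|apply Ccont_const].
Qed.

Lemma CInt_moment (n : nat) (f : C -> C) (z : C) : disk z ->
  (forall v, disk v -> Ccont f v) ->
  CInt (fun t : R => RtoC t ^ n * f (RtoC t * z)) 0 1 (moment n f z).
Proof.
intros Hz Hf. destruct (Ccont_CInt (fun w => w ^ n * f (w * z))) as [l Hl].
- intros t Ht. now apply Ccont_moment, Hf, disk_segment.
- unfold moment. cbv beta in Hl. rewrite (CInt_unique _ _ _ _ Hl). exact Hl.
Qed.

(** Differentiation under the integral sign: the mean value inequality between t z and t w bounds
    the remainder of h uniformly in t. *)
Lemma Cdiff_moment (n : nat) (h dh : C -> C) (z : C) : disk z ->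
  (forall v, disk v -> Cdiff h v (dh v)) -> (forall v, disk v -> Ccont dh v) ->
  Cdiff (moment n h) z (moment (S n) dh z).
Proof.
intros Hz Hh Hdh. apply Cdiff_iff. intros eps Heps.
assert (Hc : forall v, disk v -> Ccont h v).
{ intros v Hv. eapply Cdiff_cont, Hh, Hv. }
destruct (segment_uniform_cont dh z eps Hz Hdh Heps) as [d [Hd H]].
exists d; split; [exact Hd|]. intros w Hw.
assert (Hwd : disk w).
{ apply (H 1%R w); [lra|]. now rewrite Cmult_1_l. }
assert (I := CInt_plus _ _ _ _ _ _ (CInt_moment n h w Hwd Hc)
  (CInt_plus _ _ _ _ _ _ (CInt_scal _ _ _ (- (1)) _ (CInt_moment n h z Hz Hc))
     (CInt_scal _ _ _ (- (w - z)) _ (CInt_moment (S n) dh z Hz Hdh)))).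
replace (moment n h w - moment n h z - (w - z) * moment (S n) dh z) with
  (moment n h w + (- (1) * moment n h z + - (w - z) * moment (S n) dh z)) by ring.
apply (CInt_bound _ _ _ I). intros t Ht.
assert (Hseg : forall s : R, (0 <= s <= 1)%R -> disk (t * z + s * (t * (w - z))) /\
  (Cmod (dh (t * z + s * (t * (w - z)))%C - dh (t * z)%C) < eps)%R).
{ intros s Hs. apply H; [exact Ht|].
  replace (t * z + s * (t * (w - z)) - t * z) with ((s * t)%R * (w - z)) by (rewrite RtoC_mult; ring).
  assert (Hst : (0 <= s * t <= 1)%R) by nra.
  rewrite Cmod_mult, Cmod_R, Rabs_pos_eq by lra. assert (Hp := Cmod_ge_0 (w - z)).
  generalize dependent (s * t)%R. intros p Hp1. nra. }
assert (E : (Cmod (h (t * z + t * (w - z))%C - h (t * z)%C - t * (w - z) * dh (t * z)%C)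
  <= eps * Cmod (t * (w - z)))%R).
{ apply (C_mean_value h dh).
  - now apply Hc, disk_segment.
  - replace (t * z + t * (w - z)) with (t * z + 1%R * (t * (w - z))) by ring. apply Hc, Hseg; lra.
  - intros s Hs. apply Hh, Hseg; lra.
  - intros s Hs. now apply Rlt_le, Hseg. }
replace (t * z + t * (w - z)) with (t * w) in E by ring.
replace (RtoC t ^ n * h (t * w)%C + (- (1) * (RtoC t ^ n * h (t * z)%C) +
   - (w - z) * (RtoC t ^ S n * dh (t * z)%C))) with
  (RtoC t ^ n * (h (t * w)%C - h (t * z)%C - t * (w - z) * dh (t * z)%C)) by (simpl; ring).
rewrite Cmod_mult, Cmod_pow, Cmod_R, Rabs_pos_eq by lra.
rewrite Cmod_mult, Cmod_R, Rabs_pos_eq in E by lra.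
assert (Hp := Cmod_ge_0 (w - z)).
assert (Hpw : (0 <= t ^ n <= 1)%R).
{ split; [apply pow_le; lra|]. rewrite <- (pow1 n). apply pow_incr; lra. }
assert (E2 : (eps * (t * Cmod (w - z)) <= eps * Cmod (w - z))%R).
{ apply Rmult_le_compat_l; nra. }
assert (E3 := Cmod_ge_0 (h (t * w)%C - h (t * z)%C - t * (w - z) * dh (t * z)%C)). nra.
Qed.

(** Integrate the derivative of t^(n + 1) h (t z) over [0, 1]; the boundary term at 0 vanishes. For
    n = c this is z G' + (1 + c) G = (1 + c) h up to the factor 1 + c. *)
Lemma moment_by_parts (n : nat) (h dh : C -> C) (z : C) : disk z ->
  (forall v, disk v -> Cdiff h v (dh v)) -> (forall v, disk v -> Ccont dh v) ->
  z * moment (S n) dh z + RtoC (INR (S n)) * moment n h z = h z.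
Proof.
intros Hz Hh Hdh.
assert (Hc : forall v, disk v -> Ccont h v).
{ intros v Hv. eapply Cdiff_cont, Hh, Hv. }
assert (Hpow : forall (w : C), Cdiff (fun w => w ^ S n) w (RtoC (INR (S n)) * w ^ n)).
{ clear. intros w. induction n as [|n IH].
  - eapply Cdiff_eq.
    + apply (Cdiff_mult (fun w => w) (fun _ => 1)); [apply Cdiff_id|apply Cdiff_const].
    + simpl. ring.
  - eapply Cdiff_eq.
    + apply (Cdiff_mult (fun w => w) (fun w => w ^ S n)); [apply Cdiff_id|exact IH].
    + rewrite (S_INR (S n)), RtoC_plus. simpl (w ^ _). ring. }
assert (I : CInt (fun t : R => z * (RtoC t ^ S n * dh (RtoC t * z)) +
  RtoC (INR (S n)) * (RtoC t ^ n * h (RtoC t * z))) 0 1 (1 ^ S n * h (1 * z) - 0 ^ S n * h (0 * z))).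
{ apply (CInt_derive (fun w => w ^ S n * h (w * z))
    (fun w => z * (w ^ S n * dh (w * z)) + RtoC (INR (S n)) * (w ^ n * h (w * z)))); intros t Ht.
  - eapply Cdiff_eq.
    + apply Cdiff_mult; [apply Hpow|].
      apply (Cdiff_comp h (fun w => w * z)); [now apply Hh, disk_segment|].
      apply Cdiff_mult; [apply Cdiff_id|apply Cdiff_const].
    + cbv beta. ring.
  - apply Ccont_plus; apply Ccont_scal.
    + now apply Ccont_moment, Hdh, disk_segment.
    + now apply Ccont_moment, Hc, disk_segment. }
assert (J := CInt_plus _ _ _ _ _ _ (CInt_scal _ _ _ z _ (CInt_moment (S n) dh z Hz Hdh))
   (CInt_scal _ _ _ (RtoC (INR (S n))) _ (CInt_moment n h z Hz Hc))).
rewrite <- (CInt_unique _ _ _ _ J), (CInt_unique _ _ _ _ I).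
assert (H1 : forall m, 1 ^ m = RtoC 1) by (induction m as [|m IH]; simpl; [|rewrite IH]; ring).
rewrite H1. simpl. rewrite !Cmult_1_l. ring.
Qed.

(** * The differential equations and the theorem *)

(** For every real K the direction z0 (-1 + i K) points into the disk, so Re u does not increase
    along it: - Re (z0 D) - K Im (z0 D) <= 0. Then K = 0 gives the sign, and arbitrary K forces the
    imaginary part to vanish. *)
Lemma max_on_circle_derive (u : C -> C) (z0 D : C) : Cdiff u z0 D ->
  (forall w, (Cmod w <= Cmod z0)%R -> (Re (u w) <= Re (u z0))%R) ->
  (0 <= Re (z0 * D))%R /\ Im (z0 * D) = 0%R.
Proof.
intros HD Hmax.
assert (Hdir : forall K : R, (Re (z0 * (-1, K) * D) <= 0)%R).
{ intros K. apply Rnot_lt_le. intros Hlt.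
  set (b := z0 * (-1, K)) in *.
  assert (Hder : is_derive (fun t : R => Re (u (z0 + t * b))) 0 (Re (b * D))).
  { apply is_derive_Re_path. now replace (z0 + 0 * b) with z0 by ring. }
  apply is_derive_Reals in Hder. destruct (Hder (Re (b * D)) Hlt) as [d Hd].
  assert (Hd0 := cond_pos d).
  (* The condition t (1 + K^2) <= 2 amounts to |1 + t (-1 + i K)| <= 1. *)
  set (t := Rmin (d / 2) (2 / (1 + K * K))).
  assert (HK : (0 < 1 + K * K)%R) by nra.
  assert (Ht : (0 < t)%R) by (apply Rmin_pos; [lra|apply Rdiv_lt_0_compat; lra]).
  assert (Htd : (t <= d / 2)%R) by apply Rmin_l.
  assert (HtK : (t * (1 + K * K) <= 2)%R).
  { assert (Hx : (t <= 2 / (1 + K * K))%R) by apply Rmin_r.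
    apply Rmult_le_compat_r with (r := (1 + K * K)%R) in Hx; [|lra].
    replace (2 / (1 + K * K) * (1 + K * K))%R with 2%R in Hx by (field; lra). exact Hx. }
  specialize (Hd t ltac:(lra)). rewrite Rabs_pos_eq in Hd by lra. specialize (Hd ltac:(lra)).
  rewrite Rplus_0_l in Hd. replace (z0 + 0 * b) with z0 in Hd by ring.
  apply Rabs_def2 in Hd. destruct Hd as [_ Hd].
  assert (Hq : (0 < (Re (u (z0 + t * b)%C) - Re (u z0)) / t)%R) by lra.
  apply Rmult_lt_compat_r with (r := t) in Hq; [|exact Ht].
  replace ((Re (u (z0 + t * b)%C) - Re (u z0)) / t * t)%R with
    (Re (u (z0 + t * b)%C) - Re (u z0))%R in Hq by (field; lra).
  specialize (Hmax (z0 + t * b)). assert ((Re (u (z0 + t * b)%C) <= Re (u z0))%R); [|lra].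
  apply Hmax. unfold b. replace (z0 + t * (z0 * (-1, K))) with (z0 * (1 + t * (-1, K))) by ring.
  rewrite Cmod_mult. rewrite <- (Rmult_1_r (Cmod z0)) at 2.
  apply Rmult_le_compat_l; [apply Cmod_ge_0|].
  apply Rsqr_incr_0_var; [|lra]. rewrite Rsqr_pow2, Cmod2_alt. unfold Rsqr, Re, Im; simpl. nra. }
assert (E : forall K : R, (- Re (z0 * D) - K * Im (z0 * D) <= 0)%R).
{ intros K. replace (- Re (z0 * D) - K * Im (z0 * D))%R with (Re (z0 * (-1, K) * D)); [apply Hdir|].
  unfold Re, Im; simpl; ring. }
split.
- specialize (E 0%R). lra.
- apply NNPP. intros Hne. specialize (E (- (Re (z0 * D) + 1) / Im (z0 * D))%R).
  replace (- (Re (z0 * D) + 1) / Im (z0 * D) * Im (z0 * D))%R with (- (Re (z0 * D) + 1))%R in E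
    by (field; exact Hne). lra.
Qed.

(** A maximum point over |w| <= |z| is also one over the possibly smaller disk that has it on its
    boundary, the form used by [max_on_circle_derive]. *)
Lemma closed_disk_max (u : C -> C) (z : C) : disk z -> (forall v, disk v -> Ccont u v) ->
  exists z0, disk z0 /\ (Re (u z) <= Re (u z0))%R /\
    forall w, (Cmod w <= Cmod z0)%R -> (Re (u w) <= Re (u z0))%R.
Proof.
intros Hz Hu. unfold disk in *.
destruct (compact_max (fun w => (Cmod w <= Cmod z)%R) (fun w => Re (u w)) (Cmod z))
  as [m [Hm Hmax]].
- exists z; lra.
- trivial.
- intros w Hw. replace w with (w - 0) by ring. apply closed_disk_closed.
  intros d Hd. destruct (Hw d Hd) as [v [Hv H]]. exists v; split; [|exact H].
  now replace (v - 0) with v by ring.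
- intros w Hw eps Heps. destruct (Hu w ltac:(lra) eps Heps) as [d [Hd H]].
  exists d; split; [exact Hd|]. intros v _ Hv. specialize (H v Hv).
  assert (H1 := Re_le_Cmod (u v - u w)).
  replace (Re (u v - u w)) with (Re (u v) - Re (u w))%R in H1 by reflexivity. lra.
- exists m. repeat split; [lra|apply Hmax; lra|]. intros w Hw. apply Hmax. lra.
Qed.

(* At a minimum of [Re s] on a closed disk, [z s'] is a nonpositive real, so [(q + c) s >= 1]. *)
Lemma Re_pos_of_ode (s ds q : C -> C) (c : R) : (0 <= c)%R ->
  (forall z, disk z -> Cdiff s z (ds z)) -> (forall z, disk z -> (0 < Re (q z))%R) ->
  (forall z, disk z -> z * ds z + (q z + c) * s z = 1) ->
  forall z, disk z -> (0 < Re (s z))%R.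
Proof.
intros Hc Hs Hq Hode z Hz.
destruct (closed_disk_max (fun z => - s z) z Hz) as [z0 [Hz0 [Hle Hmax]]].
{ intros v Hv. eapply Cdiff_cont, Cdiff_opp, Hs, Hv. }
destruct (max_on_circle_derive _ z0 _ (Cdiff_opp _ _ _ (Hs z0 Hz0)) Hmax) as [HR HI].
specialize (Hode z0 Hz0). specialize (Hq z0 Hz0).
replace (z0 * - ds z0) with (- (z0 * ds z0)) in HR, HI by ring.
set (P := z0 * ds z0) in *.
assert (0 < Re (s z0))%R.
{ clearbody P. assert (E1 := f_equal fst Hode). assert (E2 := f_equal snd Hode).
  destruct P as [p1 p2], (s z0) as [x y], (q z0) as [a b]. unfold Re, Im in *. simpl in *.
  assert (E1' : (1 - p1 = (a + c) * x - b * y)%R) by lra.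
  assert (E2' : ((a + c) * y + b * x = 0)%R) by lra.
  (* The real part of 1 - P = (q + c) s multiplied by conj (q + c), P being real. *)
  assert (E3 : (x * ((a + c) * (a + c) + b * b) = (1 - p1) * (a + c))%R).
  { transitivity (((a + c) * x - b * y) * (a + c) + b * ((a + c) * y + b * x))%R; [ring|].
    rewrite E1', E2'. ring. }
  assert (0 < (1 - p1) * (a + c))%R by (apply Rmult_lt_0_compat; lra).
  apply Rmult_lt_reg_r with ((a + c) * (a + c) + b * b)%R; nra. }
unfold Re in *; simpl in *. lra.
Qed.

(* At a point where [Re (k p)] is minimal on a closed disk, [k z p'] is a nonpositive real, hence
   [Re (k q) <= Re (k p)] there since [q - p = z p' s] with [Re s > 0]. *)
Lemma convex_range_of_ode (A : C -> Prop) (p dp s q : C -> C) : convex A ->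
  (forall v, A v -> exists e, (0 < e)%R /\ forall u, (Cmod (u - v) < e)%R -> A u) ->
  (forall z, disk z -> Cdiff p z (dp z)) -> (forall z, disk z -> (0 < Re (s z))%R) ->
  (forall z, disk z -> A (q z)) -> (forall z, disk z -> q z = p z + z * dp z * s z) ->
  forall z, disk z -> A (p z).
Proof.
intros Hcv Hop Hp Hs HA Hode z Hz. apply NNPP. intros Hn.
destruct (convex_separation A (q z) (p z) Hcv Hop (HA z Hz) Hn) as [k Hk].
assert (Hd : forall v, disk v -> Cdiff (fun z => - k * p z) v (- k * dp v)).
{ intros v Hv. eapply Cdiff_eq; [apply Cdiff_mult; [apply Cdiff_const|apply Hp, Hv]|].
  cbv beta. ring. }
destruct (closed_disk_max (fun z => - k * p z) z Hz) as [z0 [Hz0 [Hle Hmax]]].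
{ intros v Hv. eapply Cdiff_cont, Hd, Hv. }
destruct (max_on_circle_derive _ z0 _ (Hd z0 Hz0) Hmax) as [HR HI].
specialize (Hk _ (HA z0 Hz0)). rewrite (Hode z0 Hz0) in Hk. specialize (Hs z0 Hz0).
(* Both summands have nonpositive real part, the first because P is real and nonnegative, the second
   by the choice of z0; [Hk] says that the sum is positive. *)
replace (k * (p z0 + z0 * dp z0 * s z0 - p z)) with
  (- (z0 * (- k * dp z0)) * s z0 + (- k * p z - - k * p z0)) in Hk by ring.
set (P := z0 * (- k * dp z0)) in *. clearbody P.
set (Q := - k * p z) in *. set (Q' := - k * p z0) in *. clearbody Q Q'.
destruct P as [p1 p2], (s z0) as [x y], Q, Q'. unfold Re, Im in *. simpl in *. subst p2.
assert (0 <= p1 * x)%R by (apply Rmult_le_pos; lra). nra.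
Qed.

(** * The quotient f / z and the transform as a moment *)

Lemma disk_0 : disk 0.
Proof. unfold disk. rewrite Cmod_0. lra. Qed.

(** Away from 0, h = f / z satisfies h' = h (q - 1) / z, and the right side extends continuously to
    0 because q is differentiable there. The mean value inequality on segments from 0 then shows
    that the limit of h' is the derivative of h at 0. *)
Lemma slope_log_derivative (f : C -> C) : analytic0 f ->
  (forall z : C, disk z -> z <> 0 -> f z <> 0) -> analytic (log_quotient f) ->
  let q := log_quotient f in
  let h := slope f 0 1 in
  let dh := fun z => h z * slope q 0 (C_derive q 0) z in
  (forall z, disk z -> Ccont dh z) /\ (forall z, disk z -> Cdiff h z (dh z)).
Proof.
intros [Ha [Hf0 Hf1]] Hne Hq q h dh.
assert (Hq0 : q 0 = 1).
{ unfold q, log_quotient. destruct Ceq_dec; [reflexivity|contradiction]. }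
assert (Hdf : Cdiff f 0 1) by (rewrite <- Hf1; apply analytic_Cdiff; [exact Ha|apply disk_0]).
assert (Hdq := analytic_Cdiff q 0 Hq disk_0).
assert (Hch : Ccont h 0) by now apply Ccont_slope.
assert (Hd1 : forall z, disk z -> z <> 0 -> Cdiff h z (dh z)).
{ intros z Hz Hz0. eapply Cdiff_eq.
  - apply Cdiff_slope; [exact Hz0|]. apply analytic_Cdiff; [exact Ha|exact Hz].
  - unfold dh, h. rewrite !slope_ne by exact Hz0. rewrite Hf0, Hq0.
    unfold q, log_quotient. destruct Ceq_dec; [contradiction|].
    field. split; [now apply Hne|]. now replace (z - 0) with z by ring. }
assert (Hcd : forall z, disk z -> Ccont dh z).
{ intros z Hz. unfold dh. destruct (Ceq_dec z 0) as [->|Hz0].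
  - apply Ccont_mult; [exact Hch|now apply Ccont_slope].
  - apply Ccont_mult; [eapply Cdiff_cont, Hd1; assumption|].
    eapply Cdiff_cont, Cdiff_slope; [exact Hz0|]. now apply analytic_Cdiff. }
split; [exact Hcd|]. intros z Hz. destruct (Ceq_dec z 0) as [->|Hz0]; [|now apply Hd1].
apply Cdiff_iff. intros eps Heps.
destruct (Hcd 0 disk_0 eps Heps) as [d [Hd H]].
exists (Rmin d 1); split; [apply Rmin_pos; lra|]. intros w Hw.
assert (Hwd := Rlt_le_trans _ _ _ Hw (Rmin_l _ _)).
assert (Hw1 := Rlt_le_trans _ _ _ Hw (Rmin_r _ _)).
replace (w - 0) with w in * by ring.
(* For w = 0 the segment would not leave the point where the derivative is unknown. *)
destruct (Ceq_dec w 0) as [->|Hw0].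
{ replace (h 0 - h 0 - 0 * dh 0) with (RtoC 0) by ring. rewrite Cmod_0. lra. }
replace (h w) with (h (0 + w)) by (f_equal; ring).
apply (C_mean_value h dh); [exact Hch| | |].
- replace (0 + w) with w by ring. eapply Cdiff_cont, Hd1; [exact Hw1|exact Hw0].
- intros t Ht. replace (0 + t * w) with (t * w) by ring. apply Hd1.
  + apply disk_segment; [exact Hw1|lra].
  + apply Cmult_neq_0; [|exact Hw0]. intros E. apply RtoC_inj in E. lra.
- intros t Ht. replace (0 + t * w) with (t * w) by ring. apply Rlt_le, H.
  replace (t * w - 0) with (t * w) by ring.
  rewrite Cmod_mult, Cmod_R, Rabs_pos_eq by lra. assert (Hp := Cmod_ge_0 w). nra.
Qed.

(** On the segment f (t z) = t z h (t z), so the integrand is z z^c t^c h (t z). *)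
Lemma Bernardi_moment (c : nat) (f : C -> C) (z : C) : disk z -> f 0 = 0 ->
  (forall v, disk v -> Ccont (slope f 0 1) v) ->
  Bernardi c f z = z * ((1 + RtoC (INR c)) * moment c (slope f 0 1) z).
Proof.
intros Hz Hf0 Hc. unfold Bernardi. destruct Ceq_dec as [->|Hz0]; [ring|].
assert (Hzc : z ^ c <> 0) by now apply Cpow_nz.
assert (I := CInt_scal _ _ _ (z * z ^ c) _ (CInt_moment c _ z Hz Hc)).
unfold integral_0.
(* The integrands are compared on the open interval only, which avoids the division by 0 at t =
   0. *)
rewrite (RInt_ext (V := C_R_CompleteNormedModule) _
  (fun t : R => z * z ^ c * (RtoC t ^ c * slope f 0 1 (RtoC t * z)))).
- rewrite (CInt_unique _ _ _ _ I). field. exact Hzc.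
- rewrite Rmin_left, Rmax_right by lra. intros t Ht.
  assert (Ht0 : RtoC t <> 0) by (intros E; apply RtoC_inj in E; lra).
  assert (Htz : t * z <> 0) by now apply Cmult_neq_0.
  rewrite slope_ne by exact Htz. rewrite Hf0, Cpow_mult_l.
  match goal with |- ?a = ?b => change (@eq C a b) end. field. now split.
Qed.

Theorem theorem1p2 (Psi : C -> C)
  (HPsi : convex_univalent Psi)
  (HPsi0 : Psi 0 = 1)
  (HPsi_re : forall z : C, disk z -> (0 < Re (Psi z))%R)
  (c : nat) (f : C -> C) (Hf : class_F Psi f) :
  class_F Psi (Bernardi c f).
Proof.
destruct HPsi as [HPa [HPu HPc]].
destruct Hf as [Hf0 [Hfne [Hqa [_ [om [_ [_ [Hom Hqom]]]]]]]].
destruct (slope_log_derivative f Hf0 Hfne Hqa) as [Hcdh Hdh].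
set (q := log_quotient f) in *. set (h := slope f 0 1) in *.
set (dh := fun z => h z * slope q 0 (C_derive q 0) z) in *.
assert (Hch : forall v, disk v -> Ccont h v).
{ intros v Hv. eapply Cdiff_cont, Hdh, Hv. }
assert (Hq0 : q 0 = 1).
{ unfold q, log_quotient. destruct Ceq_dec; [reflexivity|contradiction]. }
assert (HqA : forall z, disk z -> image_disk Psi (q z)).
{ intros z Hz. exists (om z). split; [now apply Hom|]. symmetry. now apply Hqom. }
assert (Hqre : forall z, disk z -> (0 < Re (q z))%R).
{ intros z Hz. rewrite Hqom by exact Hz. apply HPsi_re, Hom, Hz. }
assert (Hhne : forall z, disk z -> h z <> 0).
{ intros z Hz E. destruct (Ceq_dec z 0) as [->|Hz0].
  - unfold h in E. rewrite slope_at in E. apply RtoC_inj in E. lra.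
  - apply (Hfne z Hz Hz0). destruct Hf0 as [_ [Hf00 _]].
    replace (f z) with (f z - f 0) by (rewrite Hf00; ring).
    rewrite <- (slope_mult f 0 1). fold h. rewrite E. ring. }
assert (Hzdh : forall z, z * dh z = h z * (q z - 1)).
{ intros z. assert (E := slope_mult q 0 (C_derive q 0) z). rewrite Hq0 in E. rewrite <- E.
  unfold dh. ring. }
set (k := 1 + RtoC (INR c)).
assert (Hc0 : (0 <= INR c)%R) by apply pos_INR.
assert (Hk : k <> 0).
{ unfold k. rewrite <- RtoC_plus. intros E. apply RtoC_inj in E. lra. }
set (G := fun z => k * moment c h z).
set (dG := fun z => k * moment (S c) dh z).
assert (HG : forall z, disk z -> Cdiff G z (dG z)).
{ intros z Hz. eapply Cdiff_eq.
  - apply Cdiff_mult; [apply Cdiff_const|]. apply (Cdiff_moment c h dh z Hz Hdh Hcdh).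
  - unfold dG. cbv beta. ring. }
assert (HGode : forall z, disk z -> z * dG z + k * G z = k * h z).
{ intros z Hz. rewrite <- (moment_by_parts c h dh z Hz Hdh Hcdh). unfold G, dG, k.
  rewrite S_INR, RtoC_plus. ring. }
set (s := fun z => G z / (k * h z)).
set (ds := fun z => (dG z * (k * h z) - G z * (k * dh z)) / ((k * h z) * (k * h z))).
assert (Hs : forall z, disk z -> Cdiff s z (ds z)).
{ intros z Hz. apply (Cdiff_div G (fun z => k * h z) z (dG z) (k * dh z)); [now apply HG| |apply Cmult_neq_0; auto].
  eapply Cdiff_eq; [apply Cdiff_mult; [apply Cdiff_const|now apply Hdh]|]. unfold dh. ring. }
assert (Hsode : forall z, disk z -> z * ds z + (q z + RtoC (INR c)) * s z = 1).
{ intros z Hz. unfold ds, s.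
  replace (z * ((dG z * (k * h z) - G z * (k * dh z)) / (k * h z * (k * h z)))) with
    (((z * dG z) * (k * h z) - G z * (k * (z * dh z))) / (k * h z * (k * h z)))
    by (field; split; [now apply Hhne|exact Hk]).
  rewrite Hzdh. replace (z * dG z) with (k * h z - k * G z) by (rewrite <- (HGode z Hz); ring).
  unfold k. field. split; [now apply Hhne|exact Hk]. }
assert (Hsre := Re_pos_of_ode s ds q (INR c) Hc0 Hs Hqre Hsode).
assert (Hsne : forall z, disk z -> s z <> 0).
{ intros z Hz E. specialize (Hsre z Hz). rewrite E in Hsre. simpl in Hsre. lra. }
assert (HGs : forall z, disk z -> G z = k * h z * s z).
{ intros z Hz. unfold s. field. split; [now apply Hhne|exact Hk]. }
(* Defined through s, p is visibly differentiable at 0 as well; [HBp] identifies it with the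
   logarithmic quotient of the transform. *)
set (p := fun z => / s z - RtoC (INR c)).
set (dp := fun z => - ds z / (s z * s z)).
assert (Hp : forall z, disk z -> Cdiff p z (dp z)).
{ intros z Hz. eapply Cdiff_eq.
  - apply Cdiff_minus; [apply Cdiff_inv; [now apply Hs|now apply Hsne]|apply Cdiff_const].
  - unfold dp. ring. }
assert (Hop : forall v, image_disk Psi v ->
  exists e, (0 < e)%R /\ forall u, (Cmod (u - v) < e)%R -> image_disk Psi u).
{ intros v [z [Hz <-]]. destruct (univalent_open Psi z 1 HPa HPu Hz Rlt_0_1) as [e [He H]].
  exists e; split; [exact He|]. intros u Hu. destruct (H u Hu) as [w [Hw [_ Ew]]]. now exists w. }
assert (HpA : forall z, disk z -> image_disk Psi (p z)).
{ apply (convex_range_of_ode (image_disk Psi) p dp s q HPc Hop Hp Hsre HqA).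
  intros z Hz. specialize (Hsode z Hz). unfold p, dp.
  replace (q z) with (q z + RtoC (INR c) - RtoC (INR c)) by ring.
  (* The equation for s reads q + c = (1 - z s') / s, and p' s = - s' / s. *)
  replace (q z + RtoC (INR c)) with ((1 - z * ds z) / s z).
  - field. now apply Hsne.
  - rewrite <- Hsode. field. now apply Hsne. }
assert (HB : forall z, disk z -> Bernardi c f z = z * G z).
{ intros z Hz. apply (Bernardi_moment c f z Hz); [apply Hf0|exact Hch]. }
assert (HdB : forall z, disk z -> Cdiff (Bernardi c f) z (G z + z * dG z)).
{ intros z Hz. destruct (disk_ball z Hz) as [r [Hr Hdisk]].
  apply (Cdiff_ext_loc (fun z => z * G z) _ _ _ r Hr).
  - intros w Hw. symmetry. apply HB, Hdisk. lra.
  - eapply Cdiff_eq; [apply Cdiff_mult; [apply Cdiff_id|now apply HG]|]. cbv beta. ring. }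
assert (HG0 : G 0 = 1).
(* At z = 0 the equation for G reduces to k G 0 = k h 0, with h 0 = f' 0 = 1. *)
{ assert (E := HGode 0 disk_0). unfold h in E at 1. rewrite slope_at in E.
  replace (G 0) with ((0 * dG 0 + k * G 0) / k) by (field; exact Hk). rewrite E. field. exact Hk. }
assert (HGne : forall z, disk z -> G z <> 0).
{ intros z Hz. rewrite (HGs z Hz). apply Cmult_neq_0; [apply Cmult_neq_0|]; auto. }
assert (HBp : forall z, disk z -> log_quotient (Bernardi c f) z = p z).
{ intros z Hz. unfold log_quotient, p. destruct Ceq_dec as [->|Hz0].
  - unfold s. rewrite HG0. unfold h. rewrite slope_at.
    replace (/ (1 / (k * 1))) with k; [unfold k; ring|]. field. exact Hk.
  - rewrite (is_C_derive_unique _ _ _ (HdB z Hz)), (HB z Hz).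
    replace (z * dG z) with (k * h z - k * G z) by (rewrite <- (HGode z Hz); ring).
    unfold s, k. field. repeat split; auto. }
split; [|split].
- split; [|split].
  + intros z Hz. eexists. apply HdB, Hz.
  + rewrite (HB 0 disk_0). ring.
  + rewrite (is_C_derive_unique _ _ _ (HdB 0 disk_0)), HG0. ring.
- intros z Hz Hz0. rewrite (HB z Hz). apply Cmult_neq_0; auto.
- apply subordinate_univalent; [exact HPa|exact HPu| | |].
  + intros z Hz. destruct (disk_ball z Hz) as [r [Hr Hdisk]].
    exists (dp z). apply (Cdiff_ext_loc p _ _ _ r Hr); [|now apply Hp].
    intros w Hw. symmetry. apply HBp, Hdisk. lra.
  + unfold log_quotient. destruct Ceq_dec; [now symmetry|contradiction].
  + intros z Hz. rewrite (HBp z Hz). now apply HpA.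
Qed.
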